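(* Let $G=\prod_{n=1}^\infty\mathbb Z/2\mathbb Z$ and let $\alpha\colon G\to\operatorname{Aut}(A)$ be the infinite tensor product action on the $3^\infty$ UHF algebra $A=\bigotimes_{n=1}^\infty\bigotimes_{k=1}^\infty M_{3^k}$ constructed in the context. Then $\alpha$ has the tracial Rokhlin property with comparison and the strong modified tracial Rokhlin property, using the same choices of $p$ and $\varphi$; that is, for every finite $F\subseteq A$, finite $S\subseteq C(G)$, $\varepsilon>0$, $x\in A_+$ with $\|x\|=1$, and $y\in(A^\alpha)_+\setminus\{0\}$, there exist a projection $p\in A^\alpha$ and a unital completely positive map $\varphi\colon C(G)\to pAp$ which satisfy the conditions in the definition of the tracial Rokhlin property with comparison for $F,S,\varepsilon,x,y$ and which, together with some partial isometry $s\in A^\alpha$, also satisfy the conditions in the definition of the strong modified tracial Rokhlin property for $F,S,\varepsilon,x$.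
   Context: Construction. For $k\in\{1,2,\ldots\}$ set $r(k)=\frac12(3^k-1)$ and let $w_k\in M_{3^k}$ be the block unitary $$w_k=\begin{pmatrix}0&1_{M_{r(k)}}&0\\1_{M_{r(k)}}&0&0\\0&0&1_{\mathbb C}\end{pmatrix}.$$ Set $B=\bigotimes_{k=1}^\infty M_{3^k}$ and $\nu=\bigotimes_{k=1}^\infty\operatorname{Ad}(w_k)\in\operatorname{Aut}(B)$, an automorphism of order $2$, and let $\gamma\colon\mathbb Z/2\mathbb Z\to\operatorname{Aut}(B)$ be the action generated by $\nu$. Set $G=\prod_{n=1}^\infty\mathbb Z/2\mathbb Z$ (product topology) and $A=\bigotimes_{n=1}^\infty B$. The action $\alpha\colon G\to\operatorname{Aut}(A)$ is determined by $\alpha_{(h_1,h_2,\ldots)}(b_1\otimes b_2\otimes\cdots)=\gamma_{h_1}(b_1)\otimes\gamma_{h_2}(b_2)\otimes\cdots$ for $b_n\in B$ with $b_n=1$ for all but finitely many $n$. Notation. Actions are pointwise norm continuous; $A^\alpha$ is the fixed point algebra. For $a,b\in M_\infty(A)_+$ with $M_\infty(A)=\bigcup_nM_n(A)$, $a\precsim_A b$ means there is a sequence $(v_n)$ in $M_\infty(A)$ with $v_nbv_n^*\to a$. $\mathrm{Lt}\colon G\to\operatorname{Aut}(C(G))$ is $\mathrm{Lt}_g(f)(h)=f(g^{-1}h)$. Let $A$ be an infinite dimensional simple separable unital C*-algebra, $G$ a second countable compact group, $\alpha\colon G\to\operatorname{Aut}(A)$ an action. For finite $F\subseteq A$, $S\subseteq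 C(G)$ and $\varepsilon>0$, a unital completely positive map $\varphi\colon C(G)\to pAp$ (so $\varphi(1)=p$), with $p\in A^\alpha$ a projection, is called $(F,S,\varepsilon)$-approximately equivariant central multiplicative if $\|\varphi(f_1f_2)-\varphi(f_1)\varphi(f_2)\|<\varepsilon$ for $f_1,f_2\in S$, $\|\varphi(f)a-a\varphi(f)\|<\varepsilon$ for $f\in S,a\in F$, and $\sup_{g\in G}\|\varphi(\mathrm{Lt}_g(f))-\alpha_g(\varphi(f))\|<\varepsilon$ for $f\in S$. Definition (tracial Rokhlin property with comparison). For every finite $F\subseteq A$, finite $S\subseteq C(G)$, $\varepsilon>0$, $x\in A_+$ with $\|x\|=1$, and $y\in(A^\alpha)_+\setminus\{0\}$, there exist a projection $p\in A^\alpha$ and a unital completely positive $\varphi\colon C(G)\to pAp$ such that (1) $\varphi$ is $(F,S,\varepsilon)$-approximately equivariant central multiplicative; (2) $1-p\precsim_Ax$; (3) $1-p\precsim_{A^\alpha}y$; (4) $1-p\precsim_{A^\alpha}p$; (5) $\|pxp\|>1-\varepsilon$. Definition (strong modified tracial Rokhlin property). For every finite $F\subseteq A$, finite $S\subseteq C(G)$, $\varepsilon>0$, and $x\in A_+$ with $\|x\|=1$, there exist a partial isometry $s\in A^\alpha$, a projection $p\in A^\alpha$, and a unital completely positive contractive map $\varphi\colon C(G)\to pAp$ such that (1) $\varphi$ is $(F,S,\varepsilon)$-approximately equivariant central multiplicative; (2) $1-p\precsim_Ax$; (3) $s^*s=1-p$ and $ss^*\le p$; (4) $\|sa-as\|<\varepsilon$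 for all $a\in F$; (5) $\|pxp\|>1-\varepsilon$. *)

(* Defs.v *)
From HB Require Import structures.
From mathcomp Require Import all_boot all_order all_algebra.
From mathcomp Require Import all_classical all_reals all_analysis.
From mathcomp Require Import complex.
Set Implicit Arguments.
Unset Strict Implicit.
Unset Printing Implicit Defensive.
Import Order.TTheory GRing.Theory Num.Theory numFieldNormedType.Exports.
Local Open Scope classical_set_scope.
Local Open Scope ring_scope.
Local Open Scope complex_scope.

HB.mixin Record isStarAlgebra (C : numClosedFieldType) A
    of GRing.Algebra C A := {
  star : A -> A;
  starK : involutive star;
  starD : {morph star : a b / a + b};
  starZ : forall (c : C) (a : A), star (c *: a) = Num.conj c *: star a;
  starM : forall a b : A, star (a * b) = star b * star a }.

#[short(type="starAlgType")]
HB.structure Definition StarAlgebra (C : numClosedFieldType) :=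
  { A of GRing.Algebra C A & isStarAlgebra C A }.

(* Unital C*-algebras. The norm is a field with values in R: the structures of
   the analysis library for normed modules have no join with those for rings. *)
HB.mixin Record isCStarAlgebra (R : realType) A of StarAlgebra R[i] A := {
  cnorm : A -> R;
  cnorm_eq0 : forall a : A, cnorm a = 0 -> a = 0;
  cnormD : forall a b : A, cnorm (a + b) <= cnorm a + cnorm b;
  cnormZ : forall (c : R[i]) (a : A), cnorm (c *: a) = complex.Re `|c| * cnorm a;
  cnormM : forall a b : A, cnorm (a * b) <= cnorm a * cnorm b;
  cnorm_star : forall a : A, cnorm (star a * a) = cnorm a ^+ 2;
  cnorm_complete : forall u : nat -> A,
    (forall e : R, 0 < e -> exists N, forall m n,
       (N <= m)%N -> (N <= n)%N -> cnorm (u m - u n) < e) ->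
    exists l : A, (fun n => cnorm (u n - l)) @ \oo --> (0 : R) }.

#[short(type="cstarAlgType")]
HB.structure Definition CStarAlgebra (R : realType) :=
  { A of StarAlgebra R[i] A & isCStarAlgebra R A }.

HB.mixin Record isTopologicalGroup G of Group G & Topological G := {
  mulg_continuous : continuous (fun x : G * G => (x.1 * x.2)%g);
  invg_continuous : continuous (fun x : G => (x^-1)%g) }.

#[short(type="topologicalGroupType")]
HB.structure Definition TopologicalGroup :=
  { G of Group G & Topological G & isTopologicalGroup G }.

Section MatrixStar.
Context (R : realType) (n : nat).

Let mxstar (M : 'M[R[i]]_n.+1) := map_mx Num.conj M^T.

Let mxstarK : involutive mxstar.
Proof. by move=> M; apply/matrixP => i j; rewrite !mxE conjCK. Qed.

Let mxstarD : {morph mxstar : M N / M + N}.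
Proof. by move=> M N; apply/matrixP => i j; rewrite !mxE rmorphD. Qed.

Let mxstarZ c M : mxstar (c *: M) = Num.conj c *: mxstar M.
Proof. by apply/matrixP => i j; rewrite !mxE rmorphM. Qed.

Let mxstarM M N : mxstar (M * N) = mxstar N * mxstar M.
Proof. by rewrite /mxstar trmx_mul map_mxM. Qed.

HB.instance Definition _ := isStarAlgebra.Build R[i] 'M[R[i]]_n.+1
  mxstarK mxstarD mxstarZ mxstarM.
End MatrixStar.

Lemma isometry_continuous (K : numFieldType) (f : K -> K) :
  (forall x y, `|f x - f y| = `|x - y|) -> continuous f.
Proof.
move=> fi z; have zF : Filter (nbhs z) by exact: nbhs_filter.
apply/(@cvgrPdist_lt K K K (nbhs z) zF) => e e0.
have /(@cvgrPdist_lt K K K (nbhs z) zF id z) /(_ _ e0) : id @ z --> z.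
  exact: cvg_id.
by apply: filterS => w; rewrite fi.
Qed.

Section ContFun.
Context (R : realType) (G : topologicalGroupType).
Local Notation C := (R[i] : numFieldType).

(* contfun is the *-algebra C(G). *)
Definition cont_pred : {pred G -> R[i]} :=
  fun f => `[< continuous (f : G -> C) >].

Record contfun := ContFun { cf :> G -> R[i]; cf_cont : cf \in cont_pred }.
HB.instance Definition _ := [isSub for cf].
HB.instance Definition _ := [Choice of contfun by <:].

Lemma cont_predP (f : G -> R[i]) :
  reflect (continuous (f : G -> C)) (f \in cont_pred).
Proof. exact: asboolP. Qed.

Lemma cont_subring_closed : subring_closed cont_pred.
Proof.
split=> [|f g /cont_predP fc /cont_predP gc|f g /cont_predP fc /cont_predP gc];
  apply/cont_predP => x.
- exact: (@cvg_cst C).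
- exact: (@cvgB C C _ _ _ f g _ _ (fc x) (gc x)).
- exact: (@cvgM C _ _ _ f g _ _ (fc x) (gc x)).
Qed.
HB.instance Definition _ :=
  GRing.isSubringClosed.Build _ cont_pred cont_subring_closed.
HB.instance Definition _ := 
  GRing.SubChoice_isSubComPzRing.Build _ _ contfun (GRing.subringClosedP cont_pred).

Lemma cont_scaler_closed : scaler_closed cont_pred.
Proof.
move=> c f /cont_predP fc; apply/cont_predP => x.
exact: (@cvgM C _ _ _ (cst c) f _ _ (@cvg_cst C c _ _ _) (fc x)).
Qed.
HB.instance Definition _ :=
  GRing.isScaleClosed.Build _ _ cont_pred cont_scaler_closed.
HB.instance Definition _ := [SubZmodule_isSubLmodule of contfun by <:].

Let contfun_oner_neq0 : (1 : contfun) != 0.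
Proof.
apply/eqP => /(congr1 (fun f : contfun => f 1%g)) /eqP.
by rewrite -[_ == _]/((1 : R[i]) == 0) oner_eq0.
Qed.
HB.instance Definition _ :=
  GRing.PzSemiRing_isNonZero.Build contfun contfun_oner_neq0.

Let contfun_scalerAl (c : R[i]) (f g : contfun) : c *: (f * g) = c *: f * g.
Proof. by apply/val_inj/funext => x; exact: mulrA. Qed.
HB.instance Definition _ :=
  GRing.Lmodule_isLalgebra.Build R[i] contfun contfun_scalerAl.
HB.instance Definition _ := GRing.Lalgebra_isComAlgebra.Build R[i] contfun.

Let contstar_subproof (f : contfun) : (fun x => Num.conj (f x)) \in cont_pred.
Proof.
apply/cont_predP => x.
apply: (continuous_comp ((cont_predP _ (cf_cont f)) x)).
apply: (@isometry_continuous C Num.conj) => y z.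
by rewrite -rmorphB norm_conjC.
Qed.

Let contstar (f : contfun) : contfun := ContFun (contstar_subproof f).

Let contstarK : involutive contstar.
Proof. by move=> f; apply/val_inj/funext => x; exact: conjCK. Qed.

Let contstarD : {morph contstar : f g / f + g}.
Proof. by move=> f g; apply/val_inj/funext => x; exact: rmorphD. Qed.

Let contstarZ (c : R[i]) (f : contfun) :
  contstar (c *: f) = Num.conj c *: contstar f.
Proof. by apply/val_inj/funext => x; exact: rmorphM. Qed.

Let contstarM f g : contstar (f * g) = contstar g * contstar f.
Proof. by rewrite mulrC; apply/val_inj/funext => x; exact: rmorphM. Qed.

HB.instance Definition _ := isStarAlgebra.Build R[i] contfun
  contstarK contstarD contstarZ contstarM.

Lemma translate_subproof (g : G) (f : contfun) :
  (fun h => f (g^-1 * h)%g) \in cont_pred.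
Proof.
apply/cont_predP => h.
apply: (@continuous_comp _ _ _ (fun h : G => (g^-1 * h)%g) (f : G -> C)).
  apply: (@continuous_comp _ _ _ (fun h : G => (g^-1%g, h))
    (fun x : G * G => (x.1 * x.2)%g)); last exact: mulg_continuous.
  by apply: cvg_pair; [exact: cvg_cst | exact: cvg_id].
exact: (cont_predP _ (cf_cont f)).
Qed.

Definition Lt (g : G) (f : contfun) : contfun := ContFun (translate_subproof g f).

Definition sup_norm (f : contfun) : R := sup (range (fun g => complex.Re `|f g|)).
End ContFun.

Arguments contfun : clear implicits.

(* \prod_n Z/2Z with the product topology; the group law is written
   multiplicatively. *)
Definition Z2pow := prod_topology (fun _ : nat => discrete_topology 'Z_2).
HB.instance Definition _ := Topological.on Z2pow.

Section Z2powGroup.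
Let mul (g h : Z2pow) : Z2pow := fun n => (g n + h n :> 'Z_2).
Let one : Z2pow := fun _ => (0 : 'Z_2).
Let inv (g : Z2pow) : Z2pow := fun n => (- g n :> 'Z_2).
Let mulA : associative mul.
Proof. by move=> a b c; apply/funext => n; exact: addrA. Qed.
Let mul1 : left_id one mul.
Proof. by move=> a; apply/funext => n; exact: add0r. Qed.
Let mulone : right_id one mul.
Proof. by move=> a; apply/funext => n; exact: addr0. Qed.
Let mulV : left_inverse one inv mul.
Proof. by move=> a; apply/funext => n; exact: addNr. Qed.
Let mulVr : right_inverse one inv mul.
Proof. by move=> a; apply/funext => n; exact: addrN. Qed.
HB.instance Definition _ := isGroup.Build Z2pow mulA mul1 mulone mulV mulVr.
End Z2powGroup.

Lemma Z2pow_continuous (T : topologicalType) (f : T -> Z2pow) :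
  (forall x n, \forall y \near x, f y n = f x n) -> continuous f.
Proof.
move=> fn x; apply/cvg_sup => n A [_ [[B _ <-] Bfx] BA].
have {}fn : \forall y \near x, f y n = f x n by exact: fn.
by apply: filterS fn => y yx; apply: BA; rewrite /preimage/= yx.
Qed.

Lemma Z2pow_near (x : Z2pow) n : \forall y \near x, y n = x n.
Proof.
exact: (@proj_continuous _ (fun _ : nat => discrete_topology 'Z_2) n x _
  (discrete_set1 _)).
Qed.

Lemma Z2pow_mul_continuous : continuous (fun x : Z2pow * Z2pow => (x.1 * x.2)%g).
Proof.
apply: Z2pow_continuous => -[x y] n.
exists ([set z | z n = x n], [set z | z n = y n]).
  by split; exact: Z2pow_near.
by move=> [x' y'] /= [ex ey]; congr (_ + _ :> 'Z_2).
Qed.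

Lemma Z2pow_inv_continuous : continuous (fun x : Z2pow => (x^-1)%g).
Proof.
apply: Z2pow_continuous => x n; apply: filterS (Z2pow_near x n) => y yx.
by congr (- _ :> 'Z_2).
Qed.

HB.instance Definition _ :=
  isTopologicalGroup.Build Z2pow Z2pow_mul_continuous Z2pow_inv_continuous.

Section StarHom.
Context {R : realType}.

Definition star_hom (A B : starAlgType R[i]) (f : A -> B) : Prop :=
  [/\ linear f, {morph f : a b / a * b}, f 1 = 1 &
      {morph f : a / star a}].

Definition star_aut (A : starAlgType R[i]) (f : A -> A) : Prop :=
  star_hom f /\ bijective f.

Definition lin_indep (V : lmodType R[i]) (I : finType) (v : I -> V) : Prop :=
  forall c : I -> R[i], \sum_i c i *: v i = 0 -> forall i, c i = 0.
End StarHom.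

Section InfiniteTensor.
Context {R : realType} {D : nat -> starAlgType R[i]} {A : cstarAlgType R}.
Implicit Type iota : forall n, D n -> A.

(* d 0 (x) ... (x) d (N-1) (x) 1 (x) 1 (x) ... *)
Definition elem_tensor iota (N : nat) (d : forall n, D n) : A :=
  \prod_(i < N) iota i (d i).

(* A is a completion of the algebraic tensor product of the D n in a C*-norm.
   [itensor_inj] says that the map from the algebraic tensor product of
   D 0, ..., D (N-1) to A is injective, in terms of linearly independent
   families of the factors. A C*-norm on the algebraic tensor product is unique
   when the factors are nuclear, as matrix algebras and UHF algebras are. *)
Record infinite_tensor iota : Prop := InfiniteTensor {
  itensor_hom : forall n, star_hom (iota n);
  itensor_comm : forall m n (x : D m) (y : D n), m <> n ->
    iota m x * iota n y = iota n y * iota m x;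
  itensor_inj : forall (N : nat) (k : nat -> nat) (e : forall n, 'I_(k n) -> D n),
    (forall n, (n < N)%N -> lin_indep (e n)) ->
    lin_indep (fun s : {dffun forall i : 'I_N, 'I_(k i)} =>
      \prod_(i < N) iota i (e i (s i)));
  itensor_dense : forall (a : A) (eps : R), 0 < eps ->
    exists (N : nat) (s : seq (forall n, D n)),
      cnorm (a - \sum_(d <- s) elem_tensor iota N d) < eps }.
End InfiniteTensor.

Section MatrixAlgebras.

Definition mx_in (A : Type) (D : set A) m n (X : 'M[A]_(m, n)) : Prop :=
  forall i j, D (X i j).

Definition adjmx (C : numClosedFieldType) (A : starAlgType C) m n
  (X : 'M[A]_(m, n)) : 'M[A]_(n, m) := map_mx star X^T.

(* positivity in the *-subalgebra D and in M_n(D) *)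
Definition pos (C : numClosedFieldType) (A : starAlgType C) (D : set A)
    (a : A) : Prop := exists2 b, D b & a = star b * b.

Definition mxpos (C : numClosedFieldType) (A : starAlgType C) (D : set A) n
    (X : 'M[A]_n) : Prop :=
  exists2 Y : 'M[A]_n, mx_in D Y & X = adjmx Y *m Y.

Context {R : realType} {A : cstarAlgType R}.

(* The C*-norm of M_n(A): the norm of X as an operator on the Hilbert A-module
   A^n, whose inner product is <xi, eta> = \sum_i xi_i^* eta_i. *)
Definition hilb_norm n (xi : 'cV[A]_n) : R :=
  Num.sqrt (cnorm (\sum_i star (xi i 0) * xi i 0)).

Definition mxcnorm n (X : 'M[A]_n) : R :=
  sup [set hilb_norm (X *m xi) | xi in [set xi | hilb_norm xi <= 1]].

(* the inclusion of M_n(A) in M_N(A) as the upper left corner, for n <= N *)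
Definition padmx n N (X : 'M[A]_n) : 'M[A]_N :=
  \matrix_(i, j) if insub (i : nat) is Some i' then
                   if insub (j : nat) is Some j' then X i' j' else 0
                 else 0.

(* For a and b in M_oo(D); the product and the norm of elements of M_oo are
   computed in a matrix algebra which is large enough. *)
Definition cuntz_sub (D : set A) m n (a : 'M[A]_m) (b : 'M[A]_n) : Prop :=
  exists (d : nat -> nat) (v : forall k, 'M[A]_(d k)),
    (forall k, mx_in D (v k)) /\
    (fun k => let N := maxn (d k) (maxn m n) in
       mxcnorm (padmx N (v k) *m padmx N b *m adjmx (padmx N (v k))
                - padmx N a)) @ \oo --> (0 : R).
End MatrixAlgebras.

Section Actions.
Context {R : realType} {G : topologicalGroupType} {A : cstarAlgType R}.
Local Notation CG := (contfun R G).

Definition is_action (alpha : G -> A -> A) : Prop :=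
  [/\ forall g, star_aut (alpha g),
      forall a, alpha 1%g a = a,
      forall g h a, alpha (g * h)%g a = alpha g (alpha h a) &
      forall a g, (fun h => cnorm (alpha h a - alpha g a)) @ g --> (0 : R)].

Definition fixed_alg (alpha : G -> A -> A) : set A :=
  [set a | forall g, alpha g a = a].

Definition projection (p : A) : Prop := star p = p /\ p * p = p.

Definition partial_isometry (s : A) : Prop := s * star s * s = s.

Definition corner (p : A) : set A := [set a | p * a * p = a].

(* phi is a unital completely positive map from C(G) to p A p *)
Definition ucp (p : A) (phi : CG -> A) : Prop :=
  [/\ linear phi,
      forall f, corner p (phi f),
      phi 1 = p &
      forall n (X : 'M[CG]_n),
        mxpos setT X -> mxpos (corner p) (map_mx phi X)].

Definition contractive (phi : CG -> A) : Prop :=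
  forall f, cnorm (phi f) <= sup_norm f.

Definition approx_equivariant_central_multiplicative (alpha : G -> A -> A)
    (F : set A) (S : set CG) (eps : R) (phi : CG -> A) : Prop :=
  [/\ forall f1 f2, S f1 -> S f2 ->
        cnorm (phi (f1 * f2) - phi f1 * phi f2) < eps,
      forall f a, S f -> F a -> cnorm (phi f * a - a * phi f) < eps &
      forall f, S f ->
        (ereal_sup (range (fun g =>
           (cnorm (phi (Lt g f) - alpha g (phi f)))%:E)) < eps%:E)%E].

Definition trp_comparison_conditions (alpha : G -> A -> A)
    (F : set A) (S : set CG) (eps : R) (x y p : A) (phi : CG -> A) : Prop :=
  [/\ approx_equivariant_central_multiplicative alpha F S eps phi,
      cuntz_sub setT ((1 - p)%:M : 'M[A]_1) (x%:M : 'M[A]_1),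
      cuntz_sub (fixed_alg alpha) ((1 - p)%:M : 'M[A]_1) (y%:M : 'M[A]_1),
      cuntz_sub (fixed_alg alpha) ((1 - p)%:M : 'M[A]_1) (p%:M : 'M[A]_1) &
      1 - eps < cnorm (p * x * p)].

Definition strong_modified_conditions (alpha : G -> A -> A)
    (F : set A) (S : set CG) (eps : R) (x s p : A) (phi : CG -> A) : Prop :=
  [/\ approx_equivariant_central_multiplicative alpha F S eps phi,
      cuntz_sub setT ((1 - p)%:M : 'M[A]_1) (x%:M : 'M[A]_1),
      star s * s = 1 - p /\ pos setT (p - s * star s),
      forall a, F a -> cnorm (s * a - a * s) < eps &
      1 - eps < cnorm (p * x * p)].

Definition tracial_rokhlin_comparison (alpha : G -> A -> A) : Prop :=
  forall (F : set A) (S : set CG) (eps : R) (x y : A),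
    finite_set F -> finite_set S -> 0 < eps ->
    pos setT x -> cnorm x = 1 ->
    pos (fixed_alg alpha) y -> y <> 0 ->
    exists (p : A) (phi : CG -> A),
      [/\ projection p, fixed_alg alpha p, ucp p phi &
          trp_comparison_conditions alpha F S eps x y p phi].

Definition strong_modified_tracial_rokhlin (alpha : G -> A -> A) : Prop :=
  forall (F : set A) (S : set CG) (eps : R) (x : A),
    finite_set F -> finite_set S -> 0 < eps ->
    pos setT x -> cnorm x = 1 ->
    exists (s p : A) (phi : CG -> A),
      [/\ partial_isometry s /\ fixed_alg alpha s,
          projection p /\ fixed_alg alpha p,
          ucp p phi, contractive phi &
          strong_modified_conditions alpha F S eps x s p phi].
End Actions.

Section UHF.
Context (R : realType).

Definition half_dim (k : nat) : nat := (3 ^ k).-1./2.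

Lemma half_dimE k : (half_dim k + half_dim k + 1 = (3 ^ k).-1.+1)%N.
Proof.
have o3 : odd (3 ^ k) by rewrite oddX orbT.
rewrite addnn addn1 /half_dim even_halfK //.
by move: o3; rewrite -{1}[(3 ^ k)%N]prednK ?expn_gt0.
Qed.

(* M_{3^k}; the predecessor-successor form of the size gives the ring structure *)
Definition M3 (k : nat) : starAlgType R[i] := 'M[R[i]]_((3 ^ k).-1.+1).

Definition w_mx (k : nat) : M3 k :=
  castmx (half_dimE k, half_dimE k)
    (block_mx (block_mx 0 1%:M 1%:M 0 : 'M[R[i]]_(half_dim k + half_dim k)) 0
              0 (1%:M : 'M[R[i]]_1)).

Definition Ad_w (k : nat) (m : M3 k) : M3 k := w_mx k * m * star (w_mx k).

(* the action of Z/2Z generated by an automorphism of order 2 *)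
Definition Z2_action (T : Type) (nu : T -> T) (h : 'Z_2) : T -> T := iter h nu.
End UHF.

(* Main.v *)
(* The algebra A is the closure of the increasing union of matrix algebras
   (the finite levels), on which the group acts by diagonal sign matrices in a
   basis of eigenvectors of the w_k.  Given a level containing F, x and y up to a
   small error, take k beyond the level and, in the first N copies of B, the
   k-th tensor factors M_{3^k}.  The two blocks exchanged by w_k give
   2^N orthogonal projections e_h, permuted by the group, which commute with the
   level; phi f = \sum_h f(h) e_h is a *-homomorphism with p = \sum_h e_h.
   In the eigenbasis of the \bigotimes w_k, the projection 1 - p is spanned by the
   multi-indices that contain a distinguished index, and these become rare as k
   grows.  Hence any basis vector delta_a of the level times such a multi-index
   can be sent, injectively and with prescribed characters, to a multi-index
   below p: this gives s, and it gives z with z^* z = 1 - p whose range lies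
   below v v^* for an eigenvector v of the approximation of x, or, with v in
   one spectral subspace of the action, of y.  Thus z^* y z is close to a
   multiple of 1 - p.
   Density of the finite levels needs *-homomorphisms to be contractive, which
   follows without spectral theory from the fact that a small self-adjoint
   element is the real part of a unitary. *)
Require Import Defs.
From HB Require Import structures.
From mathcomp Require Import all_boot all_order all_algebra.
From mathcomp Require Import all_classical all_reals all_analysis.
From mathcomp Require Import complex ring lra zify.
Set Implicit Arguments.
Unset Strict Implicit.
Unset Printing Implicit Defensive.
Import Order.TTheory GRing.Theory Num.Theory numFieldNormedType.Exports.
Local Open Scope classical_set_scope.
Local Open Scope ring_scope.
Local Open Scope complex_scope.

(** * Norms in C*-algebras *)

(** As 3^k is odd, the two blocks exchanged by [w_k] leave out one coordinate, and this accounts for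
    1 - p. The level costs a factor in the comparison with x and y: 1 - p has the form 1 (x) bad,
    while v v^* has rank one in the level, so each of the d basis vectors needs its own set of good
    multi-indices, disjoint from the others. With r = r(k+1) there are (2r+1)^N - (2r)^N =
    O(r^(N-1)) bad multi-indices and at least r^N good ones for each character; N and d depend only
    on the data, so k can be chosen last. Positive elements are approximated through a factor b with
    x = b^* b, which keeps the approximants positive. For y, the factor lies in the fixed point
    algebra and its approximant is averaged over finitely many coordinates of G; it is then block
    diagonal for the characters, which is what provides an eigenvector in a single spectral
    subspace. A compression that is only near 1 - p is corrected by Newton's iteration. It uses
    algebraic operations alone, hence stays inside the fixed point algebra. *)

Section RealPowers.
Variable R : realType.

(** The constant disappears under 2^n-th roots: if y < x, the powers of x / y exceed any C by
    Bernoulli's inequality. With [cnorm_sa_pow2] this replaces the spectral radius formula. *)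
Lemma pow2_tower_le (C x y : R) : 0 <= x -> 0 <= y ->
  (forall n, x ^+ (2 ^ n) <= C * y ^+ (2 ^ n)) -> x <= y.
Proof.
move=> x0 y0 H; rewrite leNgt; apply/negP => yx.
have [y00|y0'] := eqVneq y 0.
  have := H 0%N; rewrite expn0 !expr1 y00 mulr0 => x0'.
  by move: yx; rewrite y00 ltNge x0'.
have yp : 0 < y by rewrite lt0r y0'.
pose t := x / y.
have t1 : 1 < t by rewrite /t ltr_pdivlMr// mul1r.
have tn n : t ^+ (2 ^ n) <= C.
  by rewrite /t expr_div_n ler_pdivrMr ?exprn_gt0.
pose e := t - 1.
have e0 : 0 < e by rewrite subr_gt0.
have bern k : 1 + e *+ k <= t ^+ k.
  elim: k => [|k IH]; first by rewrite mulr0n addr0 expr0.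
  rewrite exprS; have -> : t = 1 + e by rewrite /e; ring.
  rewrite mulrDl mul1r -{2}/e.
  have tk : 1 <= t ^+ k by rewrite exprn_ege1// ltW.
  have -> : (1 + e) ^+ k = t ^+ k by rewrite /e; congr (_ ^+ _); ring.
  rewrite mulrSr addrA; apply: lerD => //.
  by rewrite -[leLHS]mulr1 ler_wpM2l // ltW.
pose k := (Num.truncn (C / e)).+1.
have kC : C < e *+ k.
  rewrite -mulr_natr mulrC -ltr_pdivrMr//.
  exact: truncnS_gt.
have := le_trans (bern (2 ^ k)%N) (tn k).
rewrite leNgt => /negP; apply; apply: (lt_le_trans kC).
have : e *+ k <= e *+ (2 ^ k) by rewrite ler_pMn2l// ltnW// ltn_expl.
lra.
Qed.
End RealPowers.

Section CStarNorm.
Context {R : realType}.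
Implicit Types (A : cstarAlgType R) (c : R[i]) (r : R).

Lemma Re_norm_ge0 c : 0 <= complex.Re `|c|.
Proof. by have := normr_ge0 c; rewrite lecE => /andP[]. Qed.

Lemma Re_normE c : (complex.Re `|c|)%:C = `|c|.
Proof. by rewrite RRe_real// normr_real. Qed.

Lemma Re_normN1 : complex.Re `|-1 : R[i]| = 1.
Proof. by rewrite normrN1. Qed.

Lemma Re_norm_real r : complex.Re `|r%:C| = `|r|.
Proof.
by rewrite normc_def/= expr0n/= addr0 sqrtr_sqr.
Qed.

Lemma Re_ge0_norm c : 0 <= c -> complex.Re `|c| = complex.Re c.
Proof. by move=> /ger0_norm ->. Qed.

Lemma star0 (A : starAlgType R[i]) : star (0 : A) = 0.
Proof. by apply: (addrI (star 0)); rewrite -starD !addr0. Qed.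

Lemma starN (A : starAlgType R[i]) (a : A) : star (- a) = - star a.
Proof. by apply: (addrI (star a)); rewrite -starD !subrr star0. Qed.

Lemma starB (A : starAlgType R[i]) (a b : A) : star (a - b) = star a - star b.
Proof. by rewrite starD starN. Qed.

Lemma star1 (A : starAlgType R[i]) : star (1 : A) = 1.
Proof.
have : star (1 : A) * star (star 1) = 1 by rewrite -starM mulr1 starK.
by rewrite starK mulr1.
Qed.

Lemma star_sum (A : starAlgType R[i]) (I : Type) (r : seq I) (P : pred I) (F : I -> A) :
  star (\sum_(i <- r | P i) F i) = \sum_(i <- r | P i) star (F i).
Proof. exact: (big_morph star (@starD _ A) (star0 A)). Qed.

Lemma starZr (A : starAlgType R[i]) r (a : A) : star (r%:C *: a) = r%:C *: star a.
Proof.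
by rewrite starZ; congr (_ *: _); apply: conj_Creal; rewrite complex_real.
Qed.

Lemma cnorm0 A : cnorm (0 : A) = 0.
Proof. by rewrite -(scale0r 0) cnormZ normr0 mul0r. Qed.

Lemma cnormN A (a : A) : cnorm (- a) = cnorm a.
Proof. by rewrite -scaleN1r cnormZ Re_normN1 mul1r. Qed.

Lemma cnorm_ge0 A (a : A) : 0 <= cnorm a.
Proof. have := cnormD a (- a); rewrite subrr cnorm0 cnormN; lra. Qed.
Hint Extern 0 (is_true (@Order.le _ _ _ (cnorm _))) => solve [apply: cnorm_ge0] : core.

Lemma cnormB A (a b : A) : cnorm (a - b) <= cnorm a + cnorm b.
Proof. by rewrite -(cnormN b) cnormD. Qed.

Lemma cnormC A (a b : A) : cnorm (a - b) = cnorm (b - a).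
Proof. by rewrite -cnormN opprB. Qed.

Lemma cnorm_tri A (b a c : A) : cnorm (a - c) <= cnorm (a - b) + cnorm (b - c).
Proof. by rewrite -[a - c](subrKA b) cnormD. Qed.

Lemma cnorm_gt0 A (a : A) : a <> 0 -> 0 < cnorm a.
Proof.
move=> a0; rewrite lt0r cnorm_ge0 andbT; apply/eqP => /cnorm_eq0.
exact: a0.
Qed.

Lemma cnorm_starE A (a : A) : cnorm (star a) = cnorm a.
Proof.
have H (b : A) : cnorm b <= cnorm (star b).
  have [b0|] := eqVneq (cnorm b) 0; first by rewrite b0.
  move=> b0; have bp : 0 < cnorm b by rewrite lt0r b0 cnorm_ge0.
  rewrite -(ler_pM2r bp) -expr2 -cnorm_star; exact: cnormM.
by apply/le_anti; rewrite H -{2}(starK a) H.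
Qed.

Lemma cnorm1 A : cnorm (1 : A) = 1.
Proof.
have := cnorm_star (1 : A); rewrite star1 mulr1 => H.
have : cnorm (1 : A) != 0 by apply/eqP => /cnorm_eq0/eqP; rewrite oner_eq0.
by move=> h; apply: (mulfI h); rewrite mulr1 -expr2 -H.
Qed.

Lemma cnorm_sum A (I : Type) (r : seq I) (P : pred I) (F : I -> A) :
  cnorm (\sum_(i <- r | P i) F i) <= \sum_(i <- r | P i) cnorm (F i).
Proof.
elim/big_rec2: _ => [|i y x _ H]; first by rewrite cnorm0.
by apply: le_trans (cnormD _ _) _; rewrite lerD2l.
Qed.

Lemma cnormZr A r (a : A) : cnorm (r%:C *: a) = `|r| * cnorm a.
Proof. by rewrite cnormZ Re_norm_real. Qed.

Lemma cnorm_sa_pow2 A (a : A) n : star a = a ->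
  cnorm (a ^+ (2 ^ n)) = cnorm a ^+ (2 ^ n).
Proof.
move=> sa.
have sX k : star (a ^+ k) = a ^+ k.
  by elim: k => [|k IH]; rewrite ?expr0 ?star1// exprSr starM IH sa -exprS -exprSr.
elim: n => [|n IH]; first by rewrite expn0 !expr1.
by rewrite expnSr !exprM -IH expr2 -{1}sX cnorm_star.
Qed.

Lemma cnorm_proj_le1 A (p : A) : projection p -> cnorm p <= 1.
Proof.
move=> [sp pp]; have := cnorm_star p; rewrite sp pp => H.
have [->|p0] := eqVneq (cnorm p) 0; first exact: ler01.
by rewrite (_ : cnorm p = 1)//; apply: (mulfI p0); rewrite mulr1 -expr2 -H.
Qed.

Lemma cnorm_proj A (p : A) : projection p -> p <> 0 -> cnorm p = 1.
Proof.
move=> [sp pp] p0; have := cnorm_star p; rewrite sp pp => H.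
have {}p0 : cnorm p != 0 by apply/eqP => /cnorm_eq0.
by apply: (mulfI p0); rewrite mulr1 -expr2 -H.
Qed.

Lemma cnorm_isometry_le1 A (s : A) : projection (star s * s) -> cnorm s <= 1.
Proof.
move=> /cnorm_proj_le1; rewrite cnorm_star => H.
by rewrite -(@ler_pXn2r _ 2)// ?nnegrE// expr1n.
Qed.

(** Passes an algebraic identity to the limit of a recursion. Both [u n] and [u n.+1] occur because
    a fixed point equation relates consecutive terms. *)
Lemma cnorm_limit_eq0 A (u : nat -> A) (l b : A) (C : R) :
  (fun n => cnorm (u n - l)) @ \oo --> (0 : R) ->
  (forall n, cnorm b <= C * (cnorm (u n - l) + cnorm (u n.+1 - l))) -> b = 0.
Proof.
move=> ul H; apply: cnorm_eq0; apply/eqP; rewrite eq_le cnorm_ge0 andbT.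
have ul' : (fun n => cnorm (u n.+1 - l)) @ \oo --> (0 : R).
  by have := ul; rewrite -cvg_shiftS.
have h : (fun n => C * (cnorm (u n - l) + cnorm (u n.+1 - l))) @ \oo --> C * (0 + 0).
  by apply: cvgMr; apply: cvgD.
rewrite addr0 mulr0 in h.
by apply: (cvgr_to_ge h); apply: nearW.
Qed.

End CStarNorm.
#[global] Hint Extern 0 (is_true (@Order.le _ _ _ (cnorm _))) => solve [apply: cnorm_ge0] : core.

(** * Contractivity of *-homomorphisms *)

Section StarHomTheory.
Context {R : realType} {A B : starAlgType R[i]} (f : A -> B).
Hypothesis fh : star_hom f.

Lemma star_hom0 : f 0 = 0.
Proof.
case: fh => fl _ _ _; have := fl 1 0 0.
by rewrite !scale1r addr0 => h; apply: (addrI (f 0)); rewrite addr0 -h.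
Qed.

Lemma star_homZ c a : f (c *: a) = c *: f a.
Proof. by case: fh => fl _ _ _; have := fl c a 0; rewrite star_hom0 !addr0. Qed.

Lemma star_homD : {morph f : a b / a + b}.
Proof. by case: fh => fl _ _ _ a b; have := fl 1 a b; rewrite !scale1r. Qed.

Lemma star_homN a : f (- a) = - f a.
Proof. by rewrite -scaleN1r star_homZ scaleN1r. Qed.

Lemma star_homB : {morph f : a b / a - b}.
Proof. by move=> a b; rewrite star_homD star_homN. Qed.

Lemma star_homM : {morph f : a b / a * b}.
Proof. by case: fh. Qed.

Lemma star_hom1 : f 1 = 1.
Proof. by case: fh. Qed.

Lemma star_hom_star : {morph f : a / star a}.
Proof. by case: fh. Qed.

Lemma star_hom_sum (I : Type) (r : seq I) (P : pred I) (F : I -> A) :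
  f (\sum_(i <- r | P i) F i) = \sum_(i <- r | P i) f (F i).
Proof. exact: (big_morph f star_homD star_hom0). Qed.

Lemma star_homX n a : f (a ^+ n) = f a ^+ n.
Proof.
by elim: n => [|n IH]; rewrite ?expr0 ?star_hom1// !exprS star_homM IH.
Qed.
End StarHomTheory.

Section Contractivity.
Context {R : realType}.
Implicit Types A B : cstarAlgType R.

Let half : R[i] := (2^-1 : R)%:C.

Let half_double A (a : A) : half *: (a + a) = a.
Proof.
rewrite -mulr2n -scaler_nat scalerA (_ : half * 2%:R = 1) ?scale1r//.
by rewrite /half -(rmorph_nat (real_complex R)) -rmorphM/= mulVf// pnatr_eq0.
Qed.

(* [c] is the real part of the unitary [c + i d]. *)
Lemma sa_half_le1_sqrt A (c : A) : star c = c -> cnorm c <= 2^-1 ->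
  exists d, [/\ star d = d, c * d = d * c & c * c + d * d = 1].
Proof.
move=> sc c1.
(* With d = 1 - l, the equation d^2 = 1 - c^2 becomes l = (c^2 + l^2) / 2. This map preserves the
   ball of radius 1/2 and contracts distances there by 1/2, so its iterates from 0 converge; they
   are self-adjoint and commute with c. *)
pose x := fix x n : A := if n is m.+1 then half *: (c * c + x m * x m) else 0.
have hh (a : A) : cnorm (half *: a) = 2^-1 * cnorm a.
  by rewrite /half cnormZr ger0_norm// invr_ge0.
have nM (a b : A) (r s : R) : cnorm a <= r -> cnorm b <= s ->
    cnorm (a * b) <= r * s.
  move=> ar bs; apply: (le_trans (cnormM _ _)); apply: ler_pM => //.
have cc : cnorm (c * c) <= 2^-1 * 2^-1 by exact: nM.
have xb n : cnorm (x n) <= 2^-1.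
  elim: n => [|n IH]; first by rewrite /= cnorm0 invr_ge0.
  rewrite /= hh; have := cnormD (c * c) (x n * x n); have := nM _ _ _ _ IH IH.
  lra.
have sx n : star (x n) = x n.
  elim: n => [|n IH]; first by rewrite /= star0.
  by rewrite /= /half starZr starD !starM sc IH.
have cx n : c * x n = x n * c.
  elim: n => [|n IH]; first by rewrite /= mulr0 mul0r.
  rewrite /= -scalerAr -scalerAl mulrDr mulrDl.
  by congr (_ *: (_ + _)); rewrite ?mulrA// IH -!mulrA IH.
have sqB (a b : A) : a * a - b * b = a * (a - b) + (a - b) * b.
  by rewrite mulrBr mulrBl addrA subrK.
have sqN (a b : A) : cnorm a <= 2^-1 -> cnorm b <= 2^-1 ->
    cnorm (a * a - b * b) <= cnorm (a - b).
  move=> a2 b2; rewrite sqB; have := cnormD (a * (a - b)) ((a - b) * b).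
  have := nM _ _ _ _ a2 (lexx (cnorm (a - b))).
  have := nM _ _ _ _ (lexx (cnorm (a - b))) b2.
  lra.
have step n : cnorm (x n.+1 - x n) <= 2^-1 ^+ n.
  elim: n => [|n IH].
    rewrite expr0 subr0; have := xb 1%N; lra.
  have -> : x n.+2 - x n.+1 = half *: (x n.+1 * x n.+1 - x n * x n).
    by rewrite [in LHS]/= -scalerBr opprD addrACA subrr add0r.
  rewrite hh exprS; apply: ler_wpM2l; first by rewrite invr_ge0.
  exact: le_trans (sqN _ _ (xb _) (xb _)) IH.
have tail n k : cnorm (x (n + k)%N - x n) <= 2 * 2^-1 ^+ n - 2 * 2^-1 ^+ (n + k).
  elim: k => [|k IH]; first by rewrite addn0 !subrr cnorm0.
  rewrite addnS; have := cnorm_tri (x (n + k)%N) (x (n + k).+1) (x n).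
  have := step (n + k)%N; rewrite [2^-1 ^+ (n + k).+1]exprS.
  move: IH; set u := 2^-1 ^+ (n + k); lra.
have [l xl] : exists l, (fun n => cnorm (x n - l)) @ \oo --> (0 : R).
  apply: cnorm_complete => e e0.
  have : (fun n => geometric (4 : R) (2^-1) n) @ \oo --> (0 : R).
    by apply: cvg_geometric; rewrite ger0_norm ?invr_ge0// invf_lt1// ltr1n.
  move=> /cvgrPdist_lt/(_ _ e0)[N _ HN]; exists N => m n mN nN.
  have := HN N (leqnn N); rewrite /geometric/= sub0r normrN ger0_norm; last first.
    by rewrite mulr_ge0// exprn_ge0// invr_ge0.
  have pw k : 0 <= 2^-1 ^+ k :> R by rewrite exprn_ge0// invr_ge0.
  have := tail N (m - N)%N; rewrite subnKC//.
  have := tail N (n - N)%N; rewrite subnKC//.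
  have := cnorm_tri (x N) (x m) (x n); rewrite (cnormC (x N) (x n)).
  have := pw m; have := pw n; lra.
have l2 : cnorm l <= 2^-1.
  have h : (fun n => 2^-1 + cnorm (x n - l)) @ \oo --> (2^-1 : R).
    by rewrite -[X in _ --> X]addr0; apply: cvgD => //; exact: cvg_cst.
  apply: (cvgr_to_ge h); apply: nearW => n.
  have := cnormB (x n) (x n - l); rewrite subKr; have := xb n; lra.
have sl : star l - l = 0.
  apply: (cnorm_limit_eq0 (C := 2) xl) => n.
  have := cnorm_tri (x n) (star l) l; rewrite -{1}(sx n) -starB cnorm_starE.
  rewrite (cnormC l (x n)); have := cnorm_ge0 (x n.+1 - l); lra.
have cl : c * l - l * c = 0.
  apply: (cnorm_limit_eq0 (C := 1) xl) => n.
  have -> : c * l - l * c = (x n - l) * c - c * (x n - l).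
    by rewrite mulrBl mulrBr cx opprB [RHS]addrC subrKA.
  have := cnormB ((x n - l) * c) (c * (x n - l)).
  have := nM _ _ _ _ (lexx (cnorm (x n - l))) c1.
  have := nM _ _ _ _ c1 (lexx (cnorm (x n - l))).
  have := cnorm_ge0 (x n.+1 - l); lra.
have ll : l - half *: (c * c + l * l) = 0.
  apply: (cnorm_limit_eq0 (C := 1) xl) => n.
  have := cnorm_tri (x n.+1) l (half *: (c * c + l * l)).
  rewrite {2}[x n.+1]/= -scalerBr opprD addrACA subrr add0r hh.
  have := sqN _ _ (xb n) l2; rewrite (cnormC l (x n.+1)).
  have := cnorm_ge0 (x n - l); lra.
exists (1 - l); split.
- by rewrite starB star1 (subr0_eq sl).
- by rewrite mulrBr mulrBl mulr1 mul1r (subr0_eq cl).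
- rewrite mulrBl mul1r mulrBr mulr1.
  have e : l + l = c * c + l * l.
    rewrite {1 2}(subr0_eq ll); rewrite -scalerDr; exact: half_double.
  by rewrite -(addrA 1) -opprD (addrA l) e addrK addrCA subrr addr0.
Qed.

Lemma re_of_unitary A (c d : A) :
  star c = c -> star d = d -> c * d = d * c -> c * c + d * d = 1 -> cnorm c <= 1.
Proof.
move=> sc sd cd cd1.
pose w := c + 'i *: d.
have sw : star w = c - 'i *: d.
  rewrite /w starD starZ sc sd -scaleNr; congr (_ + _ *: _).
  by rewrite conjCi.
have ww : star w * w = 1.
  rewrite sw /w mulrBl !mulrDr -!scalerAl -!scalerAr scalerA.
  rewrite -(expr2 'i) sqrCi scaleN1r -cd opprB.
  by rewrite addrACA subrr addr0.
have w1 : cnorm w = 1.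
  apply/eqP; rewrite -(@eqrXn2 _ 2)//.
  by rewrite -cnorm_star ww cnorm1 expr1n.
have ce : c = half *: (w + star w).
  by rewrite sw /w addrACA subrr addr0 half_double.
rewrite ce cnormZr ger0_norm ?invr_ge0//.
have := cnormD w (star w); rewrite cnorm_starE w1; lra.
Qed.

(** A self-adjoint element scaled to norm 1/2 is the real part of a unitary, and so its image has
    norm at most 1; this is the origin of the factor 2. *)
Lemma star_hom_bounded A B (f : A -> B) : star_hom f ->
  forall a, cnorm (f a) <= 2 * cnorm a.
Proof.
move=> fh.
have sab (c : A) : star c = c -> cnorm (f c) <= 2 * cnorm c.
  move=> sc.
  have [c0|c0] := eqVneq (cnorm c) 0.
    by rewrite (cnorm_eq0 _ c0) (star_hom0 fh) !cnorm0 mulr0.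
  pose t := (2 * cnorm c)^-1.
  have cp : 0 < 2 * cnorm c by rewrite mulr_gt0// lt0r c0 cnorm_ge0.
  have tp : 0 < t by rewrite invr_gt0.
  have [] := @sa_half_le1_sqrt A (t%:C *: c).
  - by rewrite starZr sc.
  - rewrite cnormZr gtr0_norm// /t invfM -mulrA mulVf// mulr1//.
  move=> d [sd cd cd1].
  have : cnorm (f (t%:C *: c)) <= 1.
    apply: (@re_of_unitary B _ (f d)).
    - by rewrite -(star_hom_star fh) starZr sc.
    - by rewrite -(star_hom_star fh) sd.
    - by rewrite -!(star_homM fh) cd.
    - by rewrite -!(star_homM fh) -(star_homD fh) cd1 (star_hom1 fh).
  rewrite (star_homZ fh) cnormZr gtr0_norm// /t.
  by rewrite ler_pdivrMl// mulr1.
move=> a; rewrite -(@ler_pXn2r _ 2)// ?nnegrE ?mulr_ge0//.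
rewrite -cnorm_star -(star_hom_star fh) -(star_homM fh).
apply: le_trans (sab _ _) _; first by rewrite starM starK.
rewrite cnorm_star exprMn; have := exprn_ge0 2 (cnorm_ge0 a); lra.
Qed.

(** The bound with factor 2, applied to the powers of [star a * a], loses its factor under roots. *)
Lemma star_hom_contractive A B (f : A -> B) : star_hom f ->
  forall a, cnorm (f a) <= cnorm a.
Proof.
move=> fh a; have sa : star (star a * a) = star a * a by rewrite starM starK.
rewrite -(@ler_pXn2r _ 2)// ?nnegrE//.
rewrite -!cnorm_star -(star_hom_star fh) -(star_homM fh).
apply: (@pow2_tower_le _ 2) => // n.
rewrite -!cnorm_sa_pow2//; last by rewrite -(star_hom_star fh) sa.
by rewrite -(star_homX fh); exact: star_hom_bounded.
Qed.

(** For the sum x, the powers of x^* x are again combinations of the [e t], with coefficients the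
    powers of |c t|^2. The triangle inequality then costs only the factor #|T|, which roots
    remove. *)
Lemma cnorm_orthogonal_sum A (T : finType) (e : T -> A) (c : T -> R[i]) (M : R) :
  (forall t, projection (e t)) -> (forall s t, s != t -> e s * e t = 0) ->
  0 <= M -> (forall t, complex.Re `|c t| <= M) ->
  cnorm (\sum_t c t *: e t) <= M.
Proof.
move=> ep eo M0 cM.
have mulE (c1 c2 : T -> R[i]) :
    (\sum_t c1 t *: e t) * (\sum_t c2 t *: e t) = \sum_t (c1 t * c2 t) *: e t.
  rewrite mulr_suml; apply: eq_bigr => s _.
  rewrite mulr_sumr (bigD1 s)//= big1 ?addr0; last first.
    by move=> t ts; rewrite -scalerAr -scalerAl eo 1?eq_sym// !scaler0.
  by rewrite -scalerAr -scalerAl scalerA; case: (ep s) => _ ->; rewrite mulrC.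
pose b := star (\sum_t c t *: e t) * (\sum_t c t *: e t).
have bE : b = \sum_t (`|c t| ^+ 2) *: e t.
  rewrite /b star_sum (eq_bigr (fun t => Num.conj (c t) *: e t)); last first.
    by move=> t _; rewrite starZ; case: (ep t) => ->.
  by rewrite mulE; apply: eq_bigr => t _; rewrite normCK mulrC.
have sb : star b = b by rewrite /b starM starK.
have bX n : b ^+ n.+1 = \sum_t ((`|c t| ^+ 2) ^+ n.+1) *: e t.
  elim: n => [|n IH]; first by rewrite !expr1 bE; apply: eq_bigr.
  by rewrite exprS IH bE mulE; apply: eq_bigr => t _; rewrite -exprS.
rewrite -(@ler_pXn2r _ 2)// ?nnegrE// -cnorm_star -/b.
apply: (@pow2_tower_le _ #|T|%:R); rewrite ?exprn_ge0// => n.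
rewrite -cnorm_sa_pow2// -[X in b ^+ X]prednK ?expn_gt0// bX prednK ?expn_gt0//.
apply: le_trans (cnorm_sum _ _ _) _.
rewrite mulr_natl -sumr_const; apply: ler_sum => t _.
rewrite cnormZ !normrX normr_id -[leRHS]mulr1.
have -> : complex.Re ((`|c t| ^+ 2) ^+ (2 ^ n)) =
    ((complex.Re `|c t|) ^+ 2) ^+ (2 ^ n).
  by apply: complexI; rewrite !rmorphXn/= Re_normE RRe_real ?rpredX ?normr_real.
apply: ler_pM => //; first by rewrite !exprn_ge0// Re_norm_ge0.
  by rewrite !lerXn2r// ?nnegrE ?exprn_ge0 ?Re_norm_ge0.
exact: cnorm_proj_le1.
Qed.
End Contractivity.

(** * Matrix units and the spectral theorem *)

Section MatrixUnits.
Context {R : realType} {A : starAlgType R[i]}.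

Definition matrix_units (T : finType) (E : T -> T -> A) : Prop :=
  [/\ forall s t u v, E s t * E u v = (t == u)%:R *: E s v,
      forall s t, star (E s t) = E t s &
      \sum_s E s s = 1].

Section Theory.
Context (T : finType) (E : T -> T -> A) (EU : matrix_units E).

Lemma munitM s t v : E s t * E t v = E s v.
Proof. by case: EU => -> _ _; rewrite eqxx scale1r. Qed.

Lemma munitM0 s t u v : t != u -> E s t * E u v = 0.
Proof. by case: EU => -> _ _ /negPf ->; rewrite scale0r. Qed.

Lemma munit_star s t : star (E s t) = E t s.
Proof. by case: EU. Qed.

Lemma munit_sum1 : \sum_s E s s = 1.
Proof. by case: EU. Qed.

(** The diagonal units are equivalent to one another by units commuting with p: if one of them kills
    p, so does their sum 1. *)
Lemma munit_mul_neq0 (p : A) s : (forall t u, E t u * p = p * E t u) ->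
  p <> 0 -> E s s * p <> 0.
Proof.
move=> pE p0 Esp; apply: p0.
rewrite -[p]mul1r -munit_sum1 mulr_suml big1// => t _.
by rewrite -(munitM t s t) -(munitM t s s) -!mulrA pE !mulrA -(mulrA (E t s)) Esp mulr0 mul0r.
Qed.

Lemma munit_ex : exists s : T, True.
Proof.
case: (pickP (fun _ : T => true)) => [s _|T0]; first by exists s.
by have /esym/eqP := munit_sum1; rewrite big_pred0 ?oner_eq0.
Qed.
End Theory.

Lemma munits_reindex (T U : finType) (E : T -> T -> A) (f : U -> T) :
  bijective f -> matrix_units E -> matrix_units (fun s t => E (f s) (f t)).
Proof.
move=> fb [EM ES E1]; split=> [s t u v|s t|].
- by rewrite EM (inj_eq (bij_inj fb)).
- by rewrite ES.
- rewrite -E1 (reindex f)//; exact: onW_bij.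
Qed.

Lemma munits_prod (T U : finType) (E : T -> T -> A) (F : U -> U -> A) :
  matrix_units E -> matrix_units F ->
  (forall s t u v, E s t * F u v = F u v * E s t) ->
  matrix_units (fun x y : T * U => E x.1 y.1 * F x.2 y.2).
Proof.
move=> EU FU EF; split=> [[s s'] [t t'] [u u'] [v v']|[s s'] [t t']|] /=.
- rewrite mulrA -(mulrA (E s t)) -EF mulrA -mulrA.
  case: EU => -> _ _; case: FU => -> _ _.
  rewrite -scalerAl -scalerAr scalerA; congr (_ *: _).
  by rewrite -pair_eqE/= -natrM mulnb.
- by rewrite starM (munit_star EU) (munit_star FU) EF.
- rewrite -(pair_big xpredT xpredT (fun s u => E s s * F u u))/=.
  under eq_bigr do rewrite -mulr_sumr (munit_sum1 FU) mulr1.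
  exact: munit_sum1.
Qed.

Lemma munits_trivial : matrix_units (fun _ _ : 'I_1 => 1 : A).
Proof.
split=> [s t u v|s t|]; rewrite ?star1 ?big_ord1//.
by rewrite !ord1 eqxx mulr1 scale1r.
Qed.

Section Elements.
Context (d : nat) (E : 'I_d -> 'I_d -> A) (EU : matrix_units E).
Implicit Types (X Y : 'M[R[i]]_d) (v : 'cV[R[i]]_d).

Definition mx_elem X : A := \sum_i \sum_j X i j *: E i j.

(* The element of A of the rank one operator [v (delta_a)^*]. *)
Definition vec_elem v a : A := \sum_i v i 0 *: E i a.

Lemma mx_elemM_vec X v a : mx_elem X * vec_elem v a = vec_elem (X *m v) a.
Proof.
rewrite /mx_elem mulr_suml; apply: eq_bigr => i _.
rewrite mxE scaler_suml mulr_suml; apply: eq_bigr => j _.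
rewrite /vec_elem mulr_sumr (bigD1 j)//= big1 ?addr0; last first.
  by move=> k kj; rewrite -scalerAl -scalerAr (munitM0 EU) 1?eq_sym// !scaler0.
by rewrite -scalerAl -scalerAr scalerA (munitM EU).
Qed.

Lemma mx_elemE X : mx_elem X = \sum_a vec_elem (col a X) a.
Proof.
rewrite /mx_elem exchange_big/=; apply: eq_bigr => a _.
by apply: eq_bigr => i _; rewrite mxE.
Qed.

Lemma mx_elemM X Y : mx_elem X * mx_elem Y = mx_elem (X *m Y).
Proof.
rewrite (mx_elemE Y) mulr_sumr (mx_elemE (X *m Y)); apply: eq_bigr => a _.
by rewrite mx_elemM_vec; congr vec_elem; rewrite !colE mulmxA.
Qed.

Lemma mx_elem_star X : star (mx_elem X) = mx_elem (map_mx Num.conj X^T).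
Proof.
rewrite /mx_elem star_sum exchange_big/=; apply: eq_bigr => i _.
rewrite star_sum; apply: eq_bigr => j _.
by rewrite starZ (munit_star EU) !mxE.
Qed.

Lemma mx_elem1 : mx_elem 1%:M = 1.
Proof.
rewrite -(munit_sum1 EU); apply: eq_bigr => i _.
rewrite (bigD1 i)//= big1 ?addr0 => [|j ji]; rewrite mxE.
  by rewrite eqxx scale1r.
by rewrite eq_sym (negPf ji) scale0r.
Qed.

Lemma mx_elem_diag (r : 'rV[R[i]]_d) :
  mx_elem (diag_mx r) = \sum_i r 0 i *: E i i.
Proof.
apply: eq_bigr => i _; rewrite (bigD1 i)//= big1 ?addr0 => [|j ji]; rewrite mxE.
  by rewrite eqxx mulr1n.
by rewrite eq_sym (negPf ji) mulr0n scale0r.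
Qed.

Lemma star_vec_elemM v w a b : star (vec_elem v a) * vec_elem w b =
  (\sum_i Num.conj (v i 0) * w i 0) *: E a b.
Proof.
rewrite /vec_elem star_sum mulr_suml scaler_suml; apply: eq_bigr => i _.
rewrite mulr_sumr (bigD1 i)//= big1 ?addr0 => [|j ji]; rewrite starZ (munit_star EU).
  by rewrite -scalerAl -scalerAr scalerA (munitM EU).
by rewrite -scalerAl -scalerAr (munitM0 EU) 1?eq_sym// !scaler0.
Qed.

Lemma vec_elemZ c v a : vec_elem (c *: v) a = c *: vec_elem v a.
Proof.
by rewrite /vec_elem scaler_sumr; apply: eq_bigr => i _; rewrite mxE scalerA.
Qed.
End Elements.
End MatrixUnits.

Section Spectral.
Context {R : realType} {A : cstarAlgType R}.

Lemma munit_proj (T : finType) (E : T -> T -> A) s :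
  matrix_units E -> projection (E s s).
Proof. by move=> EU; split; rewrite ?(munit_star EU)// (munitM EU). Qed.

Lemma sum_conj_eq1 d (v : 'cV[R[i]]_d) : v != 0 ->
  exists2 c : R[i], c != 0 &
    \sum_i Num.conj ((c *: v) i 0) * (c *: v) i 0 = 1.
Proof.
move=> v0; pose n2 := \sum_i Num.conj (v i 0) * v i 0.
have ge (i : 'I_d) : 0 <= Num.conj (v i 0) * v i 0 by rewrite mulrC mul_conjC_ge0.
have n20 : 0 <= n2 by apply: sumr_ge0.
have n2n0 : n2 != 0.
  apply: contra v0; rewrite psumr_eq0// => /allP h; apply/eqP/matrixP => i j.
  have := h i (mem_index_enum _); rewrite mulrC mul_conjC_eq0 ord1 mxE.
  by move=> /eqP.
pose c := (sqrtC n2)^-1.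
have cr : Num.conj c = c by apply: conj_Creal; rewrite ger0_real// invr_ge0 sqrtC_ge0.
exists c; first by rewrite invr_eq0 sqrtC_eq0.
rewrite (eq_bigr (fun i => c ^+ 2 * (Num.conj (v i 0) * v i 0))); last first.
  by move=> i _; rewrite mxE rmorphM/= cr; ring.
by rewrite -mulr_sumr -/n2 /c exprVn sqrtCK mulVf.
Qed.

(* A top eigenvector of [Y^* Y]; when [Y] is block diagonal for the
   partition of the indices by [chi], one that is supported in one block. *)
Lemma top_eigenvector d (E : 'I_d -> 'I_d -> A) (EU : matrix_units E)
    (L : eqType) (chi : 'I_d -> L) (Y : 'M[R[i]]_d) :
  (forall i j, Y i j != 0 -> chi i = chi j) ->
  exists (v : 'cV[R[i]]_d) (lam : R) (l : L),
    [/\ \sum_i Num.conj (v i 0) * v i 0 = 1,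
        map_mx Num.conj Y^T *m Y *m v = lam%:C *: v,
        cnorm (mx_elem E Y) ^+ 2 <= lam &
        forall i, v i 0 != 0 -> chi i = l].
Proof.
move=> Ychi; pose H := map_mx Num.conj Y^T *m Y.
have Hn : H \is spectral.normalmx.
  apply: spectral.hermitian_normalmx; apply/sesquilinear.is_hermitianmxP.
  rewrite expr0 scale1r /H trmx_mul map_mxM map_trmx trmxK -map_mx_comp.
  congr (_ *m _); apply/matrixP => i j; rewrite !mxE//.
  by rewrite /= conjCK.
pose P := spectral.spectralmx H; pose D := spectral.spectral_diag H.
have PU : P *m (P ^t* )%sesqui = 1%:M by apply/spectral.unitarymxP/spectral.spectral_unitarymx.
have PU' : (P ^t* )%sesqui *m P = 1%:M by apply: mulmx1C.
have Pinv : invmx P = (P ^t* )%sesqui.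
  by apply: (can_inj (mulmxK (spectral.spectral_unit H))); rewrite PU' mulVmx// spectral.spectral_unit.
have HE : H = (P ^t* )%sesqui *m diag_mx D *m P.
  by rewrite -Pinv; exact/spectral.orthomx_spectralP.
have [i0 _] := munit_ex EU.
pose k := [arg max_(i > i0) (complex.Re `|D 0 i|)]%O.
have kmax i : complex.Re `|D 0 i| <= complex.Re `|D 0 k|.
  by rewrite /k; case: arg_maxP => // j _; apply.
have Hnorm : cnorm (mx_elem E H) <= complex.Re `|D 0 k|.
  (* Such matrices give isometries of A, so the diagonalization bounds the norm of H in A by that of
     its diagonal form. *)
  have Ple1 (Q : 'M[R[i]]_d) : (Q ^t* )%sesqui *m Q = 1%:M -> cnorm (mx_elem E Q) <= 1.
    move=> QU; apply: cnorm_isometry_le1.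
    rewrite (mx_elem_star EU) (mx_elemM EU) QU (mx_elem1 EU).
    by split; rewrite ?star1 ?mulr1.
  rewrite HE -!(mx_elemM EU).
  have n1 : cnorm (mx_elem E P) <= 1 by exact: Ple1.
  have n2 : cnorm (mx_elem E (P ^t* )%sesqui) <= 1.
    by rewrite -(mx_elem_star EU) cnorm_starE.
  have n3 : cnorm (mx_elem E (diag_mx D)) <= complex.Re `|D 0 k|.
    rewrite mx_elem_diag; apply: cnorm_orthogonal_sum => //.
    - by move=> t; exact: munit_proj.
    - by move=> s t st; rewrite (munitM0 EU).
    - exact: Re_norm_ge0.
  apply: le_trans (cnormM _ _) _; rewrite -[leRHS]mulr1.
  apply: ler_pM => //; apply: le_trans (cnormM _ _) _; rewrite -[leRHS]mul1r.
  exact: ler_pM.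
pose v := col k (P ^t* )%sesqui.
have vE : v = (P ^t* )%sesqui *m delta_mx k 0 by rewrite /v colE.
have Hv : H *m v = D 0 k *: v.
  rewrite HE vE -mulmxA (mulmxA P) PU mul1mx -mulmxA scalemxAr; congr (_ *m _).
  apply/matrixP => i j; rewrite mul_diag_mx !mxE.
  by case: eqP => [->|]; rewrite ?mulr0.
have v0 : v != 0.
  apply/eqP => /(congr1 (fun w => P *m w)); rewrite mulmx0 vE mulmxA PU mul1mx.
  by move=> /matrixP/(_ k 0)/eqP; rewrite !mxE !eqxx oner_eq0.
have [s0 vs0] : exists s0, v s0 0 != 0.
  apply/existsP; rewrite -negb_forall; apply: contra v0 => /forallP h.
  by apply/eqP/matrixP => i j; rewrite ord1 [RHS]mxE; apply/eqP; exact: h.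
have Hchi i j : H i j != 0 -> chi i = chi j.
  apply: contra_neq_eq => cij; rewrite mxE big1// => l _; rewrite !mxE.
  have [->|/Ychi li] := eqVneq (Y l i) 0; first by rewrite rmorph0 mul0r.
  have [->|/Ychi lj] := eqVneq (Y l j) 0; first by rewrite mulr0.
  by rewrite -li lj eqxx in cij.
have HY : H = map_mx Num.conj Y^T *m Y by [].
clearbody v H.
(* H is block diagonal, so cutting v down to one block keeps it an eigenvector; the block of [s0] is
   one where v does not vanish. *)
pose v' : 'cV[R[i]]_d := \col_i (if chi i == chi s0 then v i 0 else 0).
have Hv' : H *m v' = D 0 k *: v'.
  apply/matrixP => i j; rewrite ord1 !mxE.
  have := congr1 (fun w : 'cV_d => w i 0) Hv; rewrite !mxE => Hvi.
  case: eqP => ci.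
    rewrite -Hvi; apply: eq_bigr => l _; rewrite mxE.
    have [->|/Hchi il] := eqVneq (H i l) 0; first by rewrite !mul0r.
    by rewrite -il ci eqxx.
  rewrite mulr0 big1// => l _; rewrite mxE.
  case: eqP => cl; last by rewrite mulr0.
  have [->|/Hchi il] := eqVneq (H i l) 0; first by rewrite !mul0r.
  by case: ci; rewrite il.
have v'0 : v' != 0.
  by apply/eqP => /matrixP/(_ s0 0)/eqP; rewrite !mxE eqxx (negPf vs0).
have [c c0 cv1] := sum_conj_eq1 v'0.
pose w := c *: v'.
have Hw : H *m w = D 0 k *: w by rewrite -scalemxAr Hv' !scalerA mulrC.
have lam0 : 0 <= D 0 k.
  have : (map_mx Num.conj w^T *m (H *m w)) 0 0 = D 0 k.
    rewrite Hw -scalemxAr mxE mxE -[RHS]mulr1 -[in RHS]cv1; congr (_ * _).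
    by apply: eq_bigr => i _; rewrite !mxE.
  move=> <-; rewrite HY -mulmxA mulmxA -map_mxM -trmx_mul.
  move: (Y *m w) => z; rewrite mxE sumr_ge0// => i _.
  by rewrite !mxE mulrC mul_conjC_ge0.
exists w, (complex.Re (D 0 k)), (chi s0); split=> //.
- by rewrite -HY Hw RRe_real// ger0_real.
- rewrite -cnorm_star (mx_elem_star EU) (mx_elemM EU) -HY -Re_ge0_norm//.
- by move=> i; rewrite !mxE; case: (chi i =P chi s0) => // _; rewrite mulr0 eqxx.
Qed.
End Spectral.

Section ChangeOfBasis.
Context {R : realType} {A : starAlgType R[i]} (T : finType).
Variables (D : T -> T -> A) (u : T -> T -> R[i]).
Hypothesis DU : matrix_units D.
Hypothesis u_real : forall s x, Num.conj (u s x) = u s x.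
Hypothesis u_row : forall s t, \sum_x u s x * u t x = (s == t)%:R.
Hypothesis u_col : forall x y, \sum_s u s x * u s y = (x == y)%:R.

(** The matrix units of the orthonormal basis formed by the rows of the real orthogonal matrix u. *)
Definition rotated_units s t : A := \sum_x \sum_y (u s x * u t y) *: D x y.

Lemma rotated_matrix_units : matrix_units rotated_units.
Proof.
split=> [s t a b|s t|].
- rewrite /rotated_units mulr_suml scaler_sumr; apply: eq_bigr => x _.
  transitivity (\sum_z \sum_y (u s x * u t z * (u a z * u b y)) *: D x y).
    rewrite mulr_suml; apply: eq_bigr => z _; rewrite mulr_sumr.
    rewrite (bigD1 z)//= [X in _ + X]big1 ?addr0 => [|z' zz]; rewrite mulr_sumr.
      by apply: eq_bigr => y _; rewrite -scalerAl -scalerAr scalerA (munitM DU).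
    rewrite big1// => y _.
    by rewrite -scalerAl -scalerAr (munitM0 DU) 1?eq_sym// !scaler0.
  rewrite exchange_big scaler_sumr /=.
  apply: eq_bigr => y _; rewrite -scaler_suml scalerA -u_row; congr (_ *: _).
  by rewrite mulr_suml; apply: eq_bigr => z _; ring.
- rewrite /rotated_units star_sum exchange_big/=; apply: eq_bigr => x _.
  rewrite star_sum; apply: eq_bigr => y _.
  by rewrite starZ (munit_star DU) rmorphM/= !u_real mulrC.
- rewrite -(munit_sum1 DU) /rotated_units exchange_big/=; apply: eq_bigr => x _.
  rewrite exchange_big/= (bigD1 x)//= [X in _ + X]big1 ?addr0 => [|y yx].
    by rewrite -scaler_suml u_col eqxx scale1r.
  by rewrite -scaler_suml u_col eq_sym (negPf yx) scale0r.
Qed.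

Lemma rotated_unitsK x y :
  D x y = \sum_s \sum_t (u s x * u t y) *: rotated_units s t.
Proof.
rewrite /rotated_units; under eq_bigr do under eq_bigr do rewrite scaler_sumr.
under eq_bigr do under eq_bigr do under eq_bigr do rewrite scaler_sumr.
under eq_bigr do rewrite exchange_big.
under eq_bigr do under eq_bigr do rewrite exchange_big.
rewrite exchange_big/= (bigD1 x)//= [X in _ + X]big1 ?addr0 => [|x' xx].
  rewrite exchange_big/= (bigD1 y)//= [X in _ + X]big1 ?addr0 => [|y' yy].
    under eq_bigr do under eq_bigr do rewrite scalerA mulrACA.
    under eq_bigr do rewrite -scaler_suml -mulr_sumr u_col eqxx mulr1.
    by rewrite -scaler_suml u_col eqxx scale1r.
  rewrite big1// => s _.
  under eq_bigr do rewrite scalerA mulrACA.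
  by rewrite -scaler_suml -mulr_sumr u_col eq_sym (negPf yy) mulr0 scale0r.
rewrite exchange_big big1//= => y' _.
under eq_bigr do under eq_bigr do rewrite scalerA mulrACA.
rewrite exchange_big big1//= => t _.
by rewrite -scaler_suml -mulr_suml u_col eq_sym (negPf xx) mul0r scale0r.
Qed.
End ChangeOfBasis.

Lemma big_option (V : nmodType) (T : finType) (F : option T -> V) :
  \sum_x F x = F None + \sum_y F (Some y).
Proof.
rewrite (bigD1 None)//=; congr (_ + _).
rewrite (reindex_omap Some id)/=; last by case.
by apply: eq_bigl => y; rewrite eqxx.
Qed.

Lemma big_prod_type (V : nmodType) (T U : finType) (F : T * U -> V) :
  \sum_p F p = \sum_x \sum_y F (x, y).
Proof. by rewrite pair_bigA; apply: eq_bigr => -[]. Qed.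

(** * The eigenbasis of w_k *)

Section Position.
Context (R : realType) (k : nat).
Local Notation r := (half_dim k).

(* [Some (i, b)] is the [i]-th coordinate of block [b] of [w_k], or the
   eigenvector of sign [b] in the span of the two coordinates [i]; [None] is the
   last coordinate, fixed by [w_k]. *)
Definition slot := option ('I_r * bool).

Definition slot_sign (s : slot) : bool := if s is Some (_, b) then b else false.

Definition slot_flip (s : slot) : slot :=
  if s is Some (i, b) then Some (i, ~~ b) else None.

Lemma slot_flipK : involutive slot_flip.
Proof. by case=> [[i b]|]//=; rewrite negbK. Qed.

Definition slot_ord (s : slot) : 'I_((3 ^ k).-1.+1) :=
  cast_ord (half_dimE k)
    (if s is Some (i, b) then lshift 1 (if b then rshift r i else lshift r i)
     else rshift (r + r) ord0).

Lemma slot_ord_bij : bijective slot_ord.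
Proof.
apply: inj_card_bij.
  move=> s t /cast_ord_inj; case: s t => [[i b]|] [[j c]|]//.
  - move=> /lshift_inj; case: b; case: c; first by move=> /rshift_inj ->.
    + by move=> /eqP; rewrite eq_rlshift.
    + by move=> /eqP; rewrite eq_lrshift.
    + by move=> /lshift_inj ->.
  - by move=> /eqP; rewrite eq_lrshift.
  - by move=> /eqP; rewrite eq_rlshift.
rewrite card_option card_prod card_bool !card_ord -half_dimE.
by rewrite muln2 -addnn addn1.
Qed.

Local Notation C := R[i].
Let D (s t : slot) : M3 R k := delta_mx (slot_ord s) (slot_ord t).

Let DU : matrix_units D.
Proof.
have := slot_ord_bij; rewrite /D => sb.
split=> [s t u v|s t|].
- rewrite /GRing.mul/= mul_delta_mx_cond (inj_eq (bij_inj sb)).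
  by case: eqP => _; rewrite ?mulr1n ?mulr0n ?scale1r ?scale0r.
- apply/matrixP => i j; rewrite !mxE andbC.
  by case: (_ && _); rewrite ?rmorph1 ?rmorph0.
- transitivity (\sum_i (delta_mx i i : M3 R k)).
    by rewrite [RHS](reindex slot_ord)//=; exact: onW_bij.
  apply/matrixP => i j; rewrite summxE (bigD1 i)//= big1 ?addr0 => [|l li].
    by rewrite !mxE eqxx/= eq_sym.
  by rewrite mxE eq_sym (negPf li).
Qed.

Let wE : w_mx R k = \sum_s D s (slot_flip s).
Proof.
have [g gK Kg] := slot_ord_bij.
apply/matrixP => i j; rewrite -(Kg i) -(Kg j); move: (g i) (g j) => {i j} s t.
rewrite summxE (bigD1 s)//= big1 ?addr0 => [|x xs]; last first.
  by rewrite mxE (can_eq gK) eq_sym (negPf xs).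
rewrite mxE !(can_eq gK) eqxx/= /w_mx castmxE /slot_ord !cast_ordK.
case: s t => [[i b]|] [[j c]|].
- rewrite block_mxEul; case: b c => -[].
  + by rewrite block_mxEdr mxE /=; case: eqP => // -[].
  + by rewrite block_mxEdl mxE; congr (nat_of_bool _)%:R; apply/idP/idP => [/eqP ->|/eqP[->]].
  + by rewrite block_mxEur mxE; congr (nat_of_bool _)%:R; apply/idP/idP => [/eqP ->|/eqP[->]].
  + by rewrite block_mxEul mxE /=; case: eqP => // -[].
- by rewrite block_mxEur mxE.
- by rewrite block_mxEdl mxE.
- by rewrite block_mxEdr mxE.
Qed.

Let Ad_wD s t : Ad_w (D s t) = D (slot_flip s) (slot_flip t).
Proof.
have wD a b : w_mx R k * D a b = D (slot_flip a) b.
  rewrite wE mulr_suml (bigD1 (slot_flip a))//= big1 ?addr0 => [|x xa].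
    by rewrite slot_flipK (munitM DU).
  by rewrite (munitM0 DU)// -(inj_eq (inv_inj slot_flipK)) slot_flipK.
have sw : star (w_mx R k) = w_mx R k.
  rewrite wE star_sum (reindex_inj (inv_inj slot_flipK))/=.
  by apply: eq_bigr => s' _; rewrite (munit_star DU) slot_flipK.
rewrite /Ad_w wD sw -{1}sw -[LHS]starK starM starK (munit_star DU) wD.
by rewrite (munit_star DU).
Qed.

(** The symmetric orthogonal matrix that acts as the 2 by 2 Hadamard matrix on each exchanged pair
    of coordinates and fixes the last one. By [u_flip] its rows are eigenvectors of [w_mx]. *)
Let u (s x : slot) : C :=
  match s, x with
  | Some (i, b), Some (j, c) => (i == j)%:R * ((-1) ^+ (b && c) / sqrtC 2)
  | None, None => 1
  | _, _ => 0
  end.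

Let uC s x : u s x = u x s.
Proof. by case: s x => [[i b]|] [[j c]|]//=; rewrite eq_sym andbC. Qed.

Let s2 : (sqrtC 2)^-1 * (sqrtC 2)^-1 = 2^-1 :> C.
Proof. by rewrite -expr2 exprVn sqrtCK. Qed.

Let u_real s x : Num.conj (u s x) = u s x.
Proof.
case: s x => [[i b]|] [[j c]|]/=; rewrite ?rmorph0 ?rmorph1//.
by apply: conj_Creal; rewrite !rpredM ?realn ?rpredX ?rpredN ?rpred1// rpredV ger0_real// sqrtC_ge0.
Qed.

Let u_row s t : \sum_x u s x * u t x = (s == t)%:R.
Proof.
rewrite big_option; case: s t => [[i b]|] [[j c]|]/=.
- rewrite mul0r add0r big_prod_type/=.
  rewrite (bigD1 i)//= [X in _ + X]big1 ?addr0 => [|l li]; last first.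
    by rewrite big1// => y _; rewrite eq_sym (negPf li) !mul0r.
  rewrite big_bool/= !eqxx !mul1r !andbT !andbF expr0.
  have [->|ij] := eqVneq i j.
    rewrite mulr1n !mul1r mulrACA s2 -signr_addb.
    have -> : (Some (j, b) == Some (j, c)) = (b == c).
      by apply/eqP/eqP => [[]|->].
    case: b c => -[]/=; rewrite ?expr0 ?expr1 ?mulN1r ?mul1r ?addNr//;
      by rewrite [RHS](splitr 1) !mul1r.
  rewrite mulr0n !mul0r !mulr0 addr0.
  by case: eqP => // -[ij']; rewrite ij' eqxx in ij.
- by rewrite mul0r add0r big1// => -[a a'] _; rewrite mulr0.
- by rewrite mulr0 add0r big1// => -[a a'] _; rewrite mul0r.
- by rewrite mul1r big1 ?addr0// => -[a a'] _; rewrite mulr0.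
Qed.

Let u_col x y : \sum_s u s x * u s y = (x == y)%:R.
Proof. by rewrite -u_row; apply: eq_bigr => s _; rewrite !(uC s). Qed.

Let u_flip s x : u s (slot_flip x) = (-1) ^+ slot_sign s * u s x.
Proof.
case: s x => [[i b]|] [[j c]|]//=; rewrite ?mulr0 ?mul1r//.
rewrite [RHS]mulrCA; congr (_ * _); rewrite mulrA -signr_addb; congr ((-1) ^+ _ / _).
by case: b c => -[].
Qed.

(* [eps] comes from an orthonormal basis of eigenvectors of [w_k], and [e] from
   the two blocks of [r(k)] coordinates which [w_k] exchanges. *)
Lemma position_units : exists (eps : slot -> slot -> M3 R k) (e : bool -> M3 R k),
  [/\ matrix_units eps,
      forall m, exists c : slot -> slot -> C, m = \sum_s \sum_t c s t *: eps s t,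
      forall s t, Ad_w (eps s t) =
        ((-1) ^+ slot_sign s * (-1) ^+ slot_sign t) *: eps s t &
      [/\ forall b, star (e b) = e b,
          forall b c, e b * e c = (b == c)%:R *: e b,
          \sum_b e b = 1 - eps None None &
          forall b, Ad_w (e b) = e (~~ b)]].
Proof.
have AwD (x y : M3 R k) : Ad_w (x + y) = Ad_w x + Ad_w y.
  by rewrite /Ad_w mulrDr mulrDl.
have AwZ (c : C) (x : M3 R k) : Ad_w (c *: x) = c *: Ad_w x.
  by rewrite /Ad_w -scalerAr -scalerAl.
have Aw0 : Ad_w (0 : M3 R k) = 0 by rewrite /Ad_w mulr0 mul0r.
have Aws (I : finType) (F : I -> M3 R k) : Ad_w (\sum_i F i) = \sum_i Ad_w (F i).
  exact: (big_morph _ AwD Aw0).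
exists (rotated_units D u), (fun b => \sum_i D (Some (i, b)) (Some (i, b))); split.
- exact: rotated_matrix_units.
- move=> m; have [g gK Kg] := slot_ord_bij.
  have -> : m = \sum_x \sum_y m (slot_ord x) (slot_ord y) *: D x y.
    rewrite {1}[m]matrix_sum_delta (reindex slot_ord)/=; last exact: onW_bij slot_ord_bij.
    by apply: eq_bigr => x _; rewrite (reindex slot_ord)//; exact: onW_bij slot_ord_bij.
  exists (fun s t => \sum_x \sum_y m (slot_ord x) (slot_ord y) * (u s x * u t y)).
  transitivity (\sum_x \sum_y \sum_s \sum_t
    (m (slot_ord x) (slot_ord y) * (u s x * u t y)) *: rotated_units D u s t).
    apply: eq_bigr => x _; apply: eq_bigr => y _.
    rewrite (rotated_unitsK D u_col) scaler_sumr; apply: eq_bigr => s _.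
    by rewrite scaler_sumr; apply: eq_bigr => t _; rewrite scalerA.
  under eq_bigr do rewrite exchange_big.
  rewrite exchange_big; apply: eq_bigr => s _.
  under eq_bigr do rewrite exchange_big.
  rewrite exchange_big; apply: eq_bigr => t _ /=.
  by rewrite scaler_suml; apply: eq_bigr => x _; rewrite scaler_suml.
- move=> s t; rewrite /rotated_units Aws (reindex_inj (inv_inj slot_flipK)) scaler_sumr.
  apply: eq_bigr => x _; rewrite Aws (reindex_inj (inv_inj slot_flipK)) scaler_sumr.
  apply: eq_bigr => y _; rewrite AwZ Ad_wD !slot_flipK !u_flip scalerA.
  by rewrite mulrACA.
- split.
  + by move=> b; rewrite star_sum; apply: eq_bigr => i _; rewrite (munit_star DU).
  + move=> b c; rewrite mulr_suml scaler_sumr; apply: eq_bigr => i _.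
    rewrite mulr_sumr (bigD1 i)//= big1 ?addr0 => [|j ji]; case: DU => -> _ _.
      have [->|bc] := eqVneq b c; first by rewrite eqxx.
      by case: eqP => [[/eqP]|]; rewrite ?(negPf bc) ?scale0r.
    by case: eqP => [[/eqP]|]; rewrite 1?eq_sym ?(negPf ji) ?scale0r.
  + rewrite -(munit_sum1 DU) big_option addrC.
    (* The last coordinate vector belongs to both bases, so the complement of the two blocks is a
       diagonal unit of the eigenbasis. *)
    have -> : rotated_units D u None None = D None None.
      rewrite /rotated_units big_option [X in X + _]big_option/= big1 => [|y _];
        last by rewrite mulr0 scale0r.
      rewrite addr0 mulr1 scale1r big1 ?addr0// => x _.
      by rewrite big1// => y _; rewrite mul0r scale0r.
    by rewrite addrK exchange_big/= big_prod_type.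
  + by move=> b; rewrite Aws; apply: eq_bigr => i _; rewrite Ad_wD.
Qed.
End Position.

Lemma prod_single (S : pzSemiRingType) (F : nat -> S) k :
  (forall i, (i < k)%N -> F i = 1) -> \prod_(i < k.+1) F i = F k.
Proof.
move=> F1; rewrite big_ord_recr/= big1 ?mul1r// => i _.
exact: F1.
Qed.

(** * The finite levels of A *)

Section Character.
Context {C : pzRingType} (N : nat).
Implicit Types (h : Z2pow) (x y : {ffun 'I_N -> bool}).

(** The value at h of the character of G given by a subset x of the first N coordinates. Characters
    take the values 1 and -1, hence are their own inverses, and multiply by [xor_ffun]. *)
Definition char_sign h x : C := \prod_(n < N) ((-1) ^+ x n) ^+ (h n : 'Z_2).

Definition xor_ffun x y : {ffun 'I_N -> bool} := [ffun n => x n (+) y n].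
End Character.

Section CharacterTheory.
Context {C : comPzRingType} (N : nat).
Implicit Types (h : Z2pow) (x y : {ffun 'I_N -> bool}).

Lemma char_sign_xor h x y :
  char_sign h (xor_ffun x y) = char_sign h x * char_sign h y :> C.
Proof.
rewrite -big_split; apply: eq_bigr => n _ /=.
by rewrite ffunE signr_addb exprMn.
Qed.

Lemma char_sign_sqr h x : char_sign h x * char_sign h x = 1 :> C.
Proof.
rewrite -big_split big1// => n _ /=.
by rewrite -exprMn -signr_addb addbb expr0 expr1n.
Qed.

Lemma char_sign_delta h n b (nN : (n < N)%N) :
  char_sign h [ffun i : 'I_N => (i == n :> nat) && b] = ((-1) ^+ b) ^+ (h n : 'Z_2) :> C.
Proof.
rewrite /char_sign (bigD1 (Ordinal nN))//= big1 ?mulr1 => [|i ni].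
  by rewrite ffunE eqxx.
rewrite ffunE (_ : (i == n :> nat) = false) ?expr0 ?expr1n//.
by apply: contraNF ni => /eqP e; apply/eqP/val_inj.
Qed.

Lemma char_sign_false h : char_sign h ([ffun=> false] : {ffun 'I_N -> bool}) = 1 :> C.
Proof. by rewrite /char_sign big1// => n _; rewrite ffunE expr0 expr1n. Qed.
End CharacterTheory.

Section Levels.
Context {R : realType}.
Context (B : cstarAlgType R) (iB : forall k : nat, M3 R k.+1 -> B).
Hypothesis Btensor : infinite_tensor (D := fun k => M3 R k.+1) iB.
Context (nu : B -> B) (Hnu : star_aut nu).
Hypothesis nuE : forall (N : nat) (m : forall k, M3 R k.+1),
  nu (elem_tensor (D := fun k => M3 R k.+1) iB N m) =
  elem_tensor (D := fun k => M3 R k.+1) iB N (fun k => Ad_w (m k)).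
Context (A : cstarAlgType R) (iA : nat -> B -> A).
Hypothesis Atensor : infinite_tensor (D := fun _ => B) iA.
Context (alpha : Z2pow -> A -> A) (Halpha : is_action alpha).
Hypothesis alphaE : forall (h : Z2pow) (N : nat) (b : nat -> B),
  alpha h (elem_tensor (D := fun _ => B) iA N b) =
  elem_tensor (D := fun _ => B) iA N (fun n => Z2_action nu (h n) (b n)).

Definition site (n k : nat) (m : M3 R k.+1) : A := iA n (iB m).

Lemma alpha_hom h : star_hom (alpha h).
Proof. by case: Halpha => /(_ h)[]. Qed.

Lemma site_hom n k : star_hom (@site n k).
Proof.
have /= ha := itensor_hom Atensor n; have /= hb := itensor_hom Btensor k.
split=> [c x y|x y||x]; rewrite /site.
- by rewrite (star_homD hb) (star_homZ hb) (star_homD ha) (star_homZ ha).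
- by rewrite (star_homM hb) (star_homM ha).
- by rewrite (star_hom1 hb) (star_hom1 ha).
- by rewrite (star_hom_star hb) (star_hom_star ha).
Qed.

Lemma site_comm n k n' k' (x : M3 R k.+1) (y : M3 R k'.+1) :
  (n, k) != (n', k') -> site n x * site n' y = site n' y * site n x.
Proof.
have [<-|/eqP nn _] := eqVneq n n'; last exact: (itensor_comm Atensor).
rewrite xpair_eqE eqxx/= => /eqP kk.
have /= ha := itensor_hom Atensor n.
by rewrite /site -!(star_homM ha) (itensor_comm Btensor).
Qed.

Lemma Ad_w1 k : Ad_w (1 : M3 R k) = 1.
Proof.
have [eps [e [U _ Ew _]]] := position_units R k.
have AwD (x y : M3 R k) : Ad_w (x + y) = Ad_w x + Ad_w y.
  by rewrite /Ad_w mulrDr mulrDl.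
have Aw0 : Ad_w (0 : M3 R k) = 0 by rewrite /Ad_w mulr0 mul0r.
rewrite -(munit_sum1 U) (big_morph _ AwD Aw0); apply: eq_bigr => s _.
by rewrite Ew -signr_addb addbb expr0 scale1r.
Qed.

(** [nuE] is applied to the elementary tensor with m in position k and 1 before it; [Ad_w1] keeps
    those entries equal to 1. [alpha_site] repeats this one tensor level higher. *)
Lemma nu_site k (m : M3 R k.+1) : nu (iB m) = iB (Ad_w m).
Proof.
pose f := eqtype.dfwith (T := fun k => M3 R k.+1) (fun k => 1) m.
have ho j := itensor_hom Btensor j.
have := nuE k.+1 f; rewrite /elem_tensor.
rewrite (prod_single (F := fun i => iB (f i))) => [|i ik]; last first.
  by rewrite /f dfwith_out ?(star_hom1 (ho i))// neq_ltn ik orbT.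
rewrite (prod_single (F := fun i => iB (Ad_w (f i)))) => [|i ik]; last first.
  by rewrite /f dfwith_out ?Ad_w1 ?(star_hom1 (ho i))// neq_ltn ik orbT.
by rewrite /f dfwith_in.
Qed.

Lemma alpha_site h n k (m : M3 R k.+1) :
  alpha h (site n m) = site n (Z2_action (@Ad_w R k.+1) (h n) m).
Proof.
pose b := eqtype.dfwith (T := fun _ => B) (fun _ => 1) (i := n) (iB m).
have ho := itensor_hom Atensor.
have := alphaE h n.+1 b; rewrite /elem_tensor.
have nu1 j : iter j nu 1 = 1.
  elim: j => //= j ->; by case: Hnu => -[].
rewrite (prod_single (F := fun i => iA i (b i))) => [|i ik]; last first.
  by rewrite /b dfwith_out ?(star_hom1 (ho i))// neq_ltn ik orbT.
rewrite (prod_single (F := fun i => iA i (Z2_action nu (h i) (b i)))) => [|i ik]; last first.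
  by rewrite /b dfwith_out ?nu1 ?(star_hom1 (ho i))// ?neq_ltn ?ik ?orbT// /Z2_action nu1 (star_hom1 (ho i)).
rewrite /b dfwith_in => ->; rewrite /site; congr iA.
rewrite /Z2_action; elim: (h n : nat) => //= j ->.
exact: nu_site.
Qed.

Lemma alpha_site_eigen h n k (m : M3 R k.+1) (c : R[i]) :
  Ad_w m = c *: m -> alpha h (site n m) = c ^+ (h n : 'Z_2) *: site n m.
Proof.
move=> mc; rewrite alpha_site -(star_homZ (site_hom n k)); congr site.
rewrite /Z2_action; elim: (nat_of_ord (h n)) => [|j IH]; first by rewrite expr0 scale1r.
by rewrite iterS IH /Ad_w -scalerAr -scalerAl -/(Ad_w m) mc scalerA exprSr.
Qed.

(** The algebra generated by the first K matrix factors of the first N copies of B. As an inductive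
    predicate it reduces commutation and the matrix form of its elements to the generators. *)
Inductive finite_level (N K : nat) : A -> Prop :=
| Level_site n k m of (n < N)%N & (k < K)%N : finite_level N K (@site n k m)
| Level_one : finite_level N K 1
| Level_scale c a of finite_level N K a : finite_level N K (c *: a)
| Level_add a b of finite_level N K a & finite_level N K b : finite_level N K (a + b)
| Level_mul a b of finite_level N K a & finite_level N K b : finite_level N K (a * b).

Lemma finite_levelS N K N' K' a : (N <= N')%N -> (K <= K')%N ->
  finite_level N K a -> finite_level N' K' a.
Proof.
move=> NN KK; elim=> {a} [n k m nN kK||c a _ IH|a b _ IHa _ IHb|a b _ IHa _ IHb].
- by apply: Level_site; [exact: leq_trans NN|exact: leq_trans KK].
- exact: Level_one.
- exact: Level_scale.
- exact: Level_add.
- exact: Level_mul.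
Qed.

Definition approximable (a : A) := forall e : R, 0 < e ->
  exists N K a0, finite_level N K a0 /\ cnorm (a - a0) < e.

Lemma approximable_level N K a : finite_level N K a -> approximable a.
Proof. by move=> fa e e0; exists N, K, a; rewrite subrr cnorm0. Qed.

Lemma approximable_closed a :
  (forall e : R, 0 < e -> exists2 b, approximable b & cnorm (a - b) < e) ->
  approximable a.
Proof.
move=> H e e0; have e2 : 0 < e / 2 by rewrite divr_gt0.
have [b bA ab] := H _ e2; have [N [K [c [cl bc]]]] := bA _ e2.
exists N, K, c; split=> //; have := cnorm_tri b a c; lra.
Qed.

Lemma approximableD a b : approximable a -> approximable b -> approximable (a + b).
Proof.
move=> aA bA e e0; have e2 : 0 < e / 2 by rewrite divr_gt0.
have [N [K [a0 [al aa]]]] := aA _ e2; have [N' [K' [b0 [bl bb]]]] := bA _ e2.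
exists (maxn N N'), (maxn K K'), (a0 + b0); split.
  apply: Level_add; first by apply: finite_levelS al; exact: leq_maxl.
  by apply: finite_levelS bl; exact: leq_maxr.
rewrite opprD addrACA; have := cnormD (a - a0) (b - b0); lra.
Qed.

Lemma approximableM a b : approximable a -> approximable b -> approximable (a * b).
Proof.
move=> aA bA e e0.
have pos (x : A) : 0 < cnorm x + 1 by rewrite ltr_wpDl.
have eb : 0 < e / 2 / (cnorm b + 1) by rewrite !divr_gt0.
have [N [K [a0 [al aa]]]] := aA _ eb.
(* The tolerance for b depends on the norm of [a0], so b is approximated second. *)
have ea : 0 < e / 2 / (cnorm a0 + 1) by rewrite !divr_gt0.
have [N' [K' [b0 [bl bb]]]] := bA _ ea.
exists (maxn N N'), (maxn K K'), (a0 * b0); split.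
  apply: Level_mul; first by apply: finite_levelS al; exact: leq_maxl.
  by apply: finite_levelS bl; exact: leq_maxr.
have -> : a * b - a0 * b0 = (a - a0) * b + a0 * (b - b0).
  by rewrite mulrBl mulrBr addrA subrK.
apply: le_lt_trans (cnormD _ _) _.
have small (x y : A) : cnorm x < e / 2 / (cnorm y + 1) -> cnorm x * cnorm y < e / 2.
  rewrite ltr_pdivlMr// mulrDr mulr1; have := cnorm_ge0 x; lra.
have := small _ _ aa; have := small _ _ bb.
have := cnormM (a - a0) b; have := cnormM a0 (b - b0).
rewrite [cnorm a0 * _]mulrC; lra.
Qed.

Lemma approximable_sum (I : Type) (r : seq I) (F : I -> A) :
  (forall i, approximable (F i)) -> approximable (\sum_(i <- r) F i).
Proof.
move=> FA; elim: r => [|i r IH]; rewrite ?big_nil ?big_cons.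
  apply: (@approximable_level 0 0); rewrite -(scale0r 1).
  exact/Level_scale/Level_one.
exact: approximableD.
Qed.

Lemma finite_level_sum N K (I : Type) (r : seq I) (F : I -> A) :
  (forall i, finite_level N K (F i)) -> finite_level N K (\sum_(i <- r) F i).
Proof.
move=> FA; elim: r => [|i r IH]; rewrite ?big_nil ?big_cons.
  rewrite -(scale0r 1); exact/Level_scale/Level_one.
exact: Level_add.
Qed.

(** Density is known in B for matrices and in A for elements of the copies of B. Approximations made
    in B survive in A because [iA n] is contractive. *)
Lemma finite_level_dense a : approximable a.
Proof.
have ab n (b : B) : approximable (iA n b).
  apply: approximable_closed => e e0.
  have [K [s bs]] := itensor_dense Btensor b e0.
  have ho := itensor_hom Atensor n.
  exists (iA n (\sum_(d <- s) elem_tensor (D := fun k => M3 R k.+1) iB K d)).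
    apply: (@approximable_level n.+1 K); rewrite (star_hom_sum ho).
    apply: finite_level_sum => d; rewrite /elem_tensor.
    rewrite (big_morph (iA n) (star_homM ho) (star_hom1 ho)).
    elim/big_ind: _ => [|x y xl yl|i _]; [exact: Level_one|exact: Level_mul|].
    exact: Level_site.
  rewrite -(star_homB ho); apply: le_lt_trans bs.
  exact: star_hom_contractive.
apply: approximable_closed => e e0.
have [N [s as_]] := itensor_dense Atensor a e0.
exists (\sum_(d <- s) elem_tensor (D := fun _ => B) iA N d) => //.
apply: approximable_sum => d; rewrite /elem_tensor.
elim/big_ind: _ => [|x y xl yl|i _]; [|exact: approximableM|exact: ab].
exact: approximable_level (Level_one 0 0).
Qed.

Lemma finite_level_comm N K a n k (m : M3 R k.+1) :
  (K <= k)%N -> finite_level N K a -> a * site n m = site n m * a.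
Proof.
move=> Kk; elim=> {a} [n' k' m' _ kK||c a _ IH|a b _ IHa _ IHb|a b _ IHa _ IHb].
- apply: site_comm; rewrite xpair_eqE negb_and; apply/orP; right.
  by rewrite neq_ltn (leq_trans kK Kk).
- by rewrite mul1r mulr1.
- by rewrite -scalerAl IH scalerAr.
- by rewrite mulrDl mulrDr IHa IHb.
- by rewrite -mulrA IHb mulrA IHa mulrA.
Qed.

(** Induction on the list of positions: a new position tensors the units so far with those of the
    eigenbasis of its [w_k], and a repeated one changes nothing. *)
Lemma sites_matrix_units N (L : seq (nat * nat)) :
  (forall x, x \in L -> (x.1 < N)%N) ->
  exists (T : finType) (E : T -> T -> A) (chi : T -> {ffun 'I_N -> bool}),
    [/\ matrix_units E,
        forall h s t, alpha h (E s t) = (char_sign h (chi s) * char_sign h (chi t)) *: E s t,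
        forall n k (m : M3 R k.+1) s t, (n, k) \notin L ->
          E s t * site n m = site n m * E s t &
        forall n k (m : M3 R k.+1), (n, k) \in L ->
          exists c : T -> T -> R[i], site n m = \sum_s \sum_t c s t *: E s t].
Proof.
elim: L => [|[n k] L IH] LN.
  exists 'I_1, (fun _ _ => 1), (fun _ => [ffun=> false]); split=> //.
  - exact: munits_trivial.
  - move=> h _ _; rewrite char_sign_sqr scale1r; exact: star_hom1 (alpha_hom h).
  - by move=> *; rewrite mulr1 mul1r.
have [|T [E [chi [EU Ea Ec Es]]]] := IH; first by move=> x xL; apply: LN; rewrite inE xL orbT.
have nN : (n < N)%N by apply: (LN (n, k)); rewrite inE eqxx.
have [nkL|nkL] := boolP ((n, k) \in L).
  exists T, E, chi; split=> // [n' k' m s t|n' k' m].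
    by rewrite inE negb_or => /andP[_]; exact: Ec.
  by rewrite inE => /orP[/eqP[-> ek]|]; [subst k'; exact: Es|exact: Es].
have [eps [_ [epsU eps_span epsw _]]] := position_units R k.+1.
pose F a b := site n (eps a b).
have sh := site_hom n k.
have FU : matrix_units F.
  case: epsU => eM eS e1; split=> [s t u v|s t|]; rewrite /F.
  - by rewrite -(star_homM sh) eM (star_homZ sh).
  - by rewrite -(star_hom_star sh) eS.
  - by rewrite -(star_hom_sum sh) e1 (star_hom1 sh).
have EF s t u v : E s t * F u v = F u v * E s t by exact: Ec.
(* An element h acts on copy n through its coordinate h n, so the sign at the new position affects
   only the n-th bit of the character. *)
pose chi' (x : T * slot k.+1) :=
  xor_ffun (chi x.1) [ffun i : 'I_N => (i == n :> nat) && slot_sign x.2].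
exists (T * slot k.+1)%type, (fun x y => E x.1 y.1 * F x.2 y.2), chi'; split.
- exact: munits_prod.
- move=> h [s a] [t b] /=; rewrite (star_homM (alpha_hom h)) Ea.
  rewrite (alpha_site_eigen _ _ (epsw a b)) -scalerAl -scalerAr scalerA.
  by rewrite /chi' !char_sign_xor !char_sign_delta// exprMn mulrACA.
- move=> n' k' m [s a] [t b] /=; rewrite inE negb_or => /andP[nk nkL'].
  by rewrite -mulrA (site_comm _ _ (_ : (n, k) != (n', k'))) 1?eq_sym// mulrA Ec// mulrA.
- move=> n' k' m; rewrite inE => /orP[/eqP[-> ek]|nkL'].
    subst k'; have [c mE] := eps_span m.
    exists (fun x y => (x.1 == y.1)%:R * c x.2 y.2).
    rewrite big_prod_type/= -[LHS]mul1r -(munit_sum1 EU) mulr_suml; apply: eq_bigr => s _.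
    rewrite mE (star_hom_sum sh) mulr_sumr; apply: eq_bigr => a _.
    rewrite big_prod_type/= (bigD1 s)//= [X in _ + X]big1 ?addr0 => [|t ts]; last first.
      by rewrite big1// => b _; rewrite eq_sym (negPf ts) mul0r scale0r.
    rewrite (star_hom_sum sh) mulr_sumr; apply: eq_bigr => b _.
    by rewrite eqxx mul1r (star_homZ sh) -scalerAr.
  have [c ->] := Es _ _ m nkL'.
  exists (fun x y => (x.2 == y.2)%:R * c x.1 y.1).
  rewrite big_prod_type; apply: eq_bigr => s _ /=.
  transitivity (\sum_a \sum_t (c s t *: E s t) * F a a).
    rewrite -[LHS]mulr1 -(munit_sum1 FU) mulr_sumr; apply: eq_bigr => a _.
    by rewrite mulr_suml.
  apply: eq_bigr => a _; rewrite big_prod_type; apply: eq_bigr => t _ /=.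
  rewrite (bigD1 a)//= big1 ?addr0 => [|b ba].
    by rewrite eqxx mul1r -scalerAl.
  by rewrite eq_sym (negPf ba) mul0r scale0r.
Qed.

(** Relabelling by ordinals turns elements of a level into d by d matrices, to which the spectral
    theorem applies. *)
Lemma level_matrix_units N K :
  exists (d : nat) (E : 'I_d -> 'I_d -> A) (chi : 'I_d -> {ffun 'I_N -> bool}),
    [/\ matrix_units E,
        forall h s t, alpha h (E s t) = (char_sign h (chi s) * char_sign h (chi t)) *: E s t,
        forall n k (m : M3 R k.+1) s t, (K <= k)%N ->
          E s t * site n m = site n m * E s t &
        forall a, finite_level N K a -> exists X, a = mx_elem E X].
Proof.
pose L := [seq (n, k) | n <- iota 0 N, k <- iota 0 K].
have LE n k : ((n, k) \in L) = (n < N)%N && (k < K)%N.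
  apply/allpairsP/andP => [[[n' k'] /= []]|[nN kK]].
    by rewrite !mem_iota !add0n => /andP[_ nN] /andP[_ kK] [-> ->].
  by exists (n, k); rewrite !mem_iota !add0n.
have [|T [E [chi [EU Ea Ec Es]]]] := @sites_matrix_units N L.
  by move=> [n k]; rewrite LE => /andP[].
pose f := @enum_val T T.
have fb : bijective f by exact: enum_val_bij.
exists #|T|, (fun i j => E (f i) (f j)), (chi \o f); split=> //.
- exact: munits_reindex.
- move=> n k m s t Kk; apply: Ec; rewrite LE negb_and; apply/orP; right.
  by rewrite -leqNgt.
- move=> a; elim=> {a} [n k m nN kK||c a _ [X ->]|a b _ [X ->] _ [Y ->]|a b _ [X ->] _ [Y ->]].
  + have [|c ->] := Es n k m; first by rewrite LE nN.
    exists (\matrix_(i, j) c (f i) (f j)).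
    rewrite (reindex f)/=; last exact: onW_bij.
    apply: eq_bigr => i _; rewrite (reindex f)/=; last exact: onW_bij.
    by apply: eq_bigr => j _; rewrite mxE.
  + exists 1%:M; rewrite mx_elem1//; exact: munits_reindex.
  + exists (c *: X); rewrite /mx_elem scaler_sumr; apply: eq_bigr => i _.
    by rewrite scaler_sumr; apply: eq_bigr => j _; rewrite mxE scalerA.
  + exists (X + Y); rewrite /mx_elem -big_split; apply: eq_bigr => i _ /=.
    by rewrite -big_split; apply: eq_bigr => j _ /=; rewrite mxE scalerDl.
  + exists (X *m Y); rewrite mx_elemM//; exact: munits_reindex.
Qed.
End Levels.

Lemma prod_comm_mul (S : pzSemiRingType) (I : eqType) (r : seq I) (F G : I -> S) :
  uniq r -> (forall i j, i != j -> F i * G j = G j * F i) ->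
  (\prod_(i <- r) F i) * (\prod_(i <- r) G i) = \prod_(i <- r) (F i * G i).
Proof.
move=> + FG; elim: r => [|x r IH]; first by rewrite !big_nil mulr1.
rewrite !big_cons /= => /andP[xr /IH <-].
rewrite -!mulrA; congr (_ * _); rewrite !mulrA; congr (_ * _).
rewrite big_seq; elim/big_rec: _ => [|i y ir yG]; first by rewrite mulr1 mul1r.
rewrite -mulrA yG !mulrA FG//.
by apply: contraNneq xr => <-.
Qed.

(** * One matrix factor in each of the first N copies of B *)

Section TopSites.
Context {R : realType}.
Context (B : cstarAlgType R) (iB : forall k : nat, M3 R k.+1 -> B).
Hypothesis Btensor : infinite_tensor (D := fun k => M3 R k.+1) iB.
Context (nu : B -> B) (Hnu : star_aut nu).
Hypothesis nuE : forall (N : nat) (m : forall k, M3 R k.+1),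
  nu (elem_tensor (D := fun k => M3 R k.+1) iB N m) =
  elem_tensor (D := fun k => M3 R k.+1) iB N (fun k => Ad_w (m k)).
Context (A : cstarAlgType R) (iA : nat -> B -> A).
Hypothesis Atensor : infinite_tensor (D := fun _ => B) iA.
Context (alpha : Z2pow -> A -> A) (Halpha : is_action alpha).
Hypothesis alphaE : forall (h : Z2pow) (N : nat) (b : nat -> B),
  alpha h (elem_tensor (D := fun _ => B) iA N b) =
  elem_tensor (D := fun _ => B) iA N (fun n => Z2_action nu (h n) (b n)).
Context (N k : nat).
Implicit Types m : 'I_N -> M3 R k.+1.
Local Notation site := (site iB iA).
Local Notation site_hom := (site_hom Btensor Atensor).
Local Notation site_comm := (site_comm Btensor Atensor).
Local Notation alpha_hom := (alpha_hom Halpha).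

Definition site_prod m : A := \prod_(i < N) site i (m i).

Lemma eq_site_prod m m' : m =1 m' -> site_prod m = site_prod m'.
Proof. by move=> mm; apply: eq_bigr => i _; rewrite mm. Qed.

Let sc (i j : 'I_N) (x y : M3 R k.+1) : i != j -> site i x * site j y = site j y * site i x.
Proof. by move=> ij; apply: site_comm; rewrite xpair_eqE negb_and; apply/orP; left. Qed.

Lemma site_prodM m m' : site_prod m * site_prod m' = site_prod (fun i => m i * m' i).
Proof.
rewrite /site_prod prod_comm_mul ?index_enum_uniq// => [|i j ij]; last exact: sc.
by apply: eq_bigr => i _; rewrite (star_homM (site_hom _ _)).
Qed.

Lemma site_prod_star m : star (site_prod m) = site_prod (fun i => star (m i)).
Proof.
rewrite /site_prod; elim: (index_enum _) (index_enum_uniq 'I_N) => [|i r IH].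
  by rewrite !big_nil star1.
rewrite !big_cons starM /= => /andP[ir /IH ->].
rewrite -(star_hom_star (site_hom _ _)) big_seq.
elim/big_rec: _ => [|j y jr yE]; first by rewrite mulr1 mul1r.
by rewrite -mulrA yE !mulrA sc//; apply: contraNneq ir => ->.
Qed.

Lemma site_prod1 : site_prod (fun _ => 1) = 1.
Proof. by rewrite /site_prod big1// => i _; rewrite (star_hom1 (site_hom _ _)). Qed.

Lemma site_prodZ (c : 'I_N -> R[i]) m :
  site_prod (fun i => c i *: m i) = (\prod_i c i) *: site_prod m.
Proof.
rewrite /site_prod; elim: (index_enum _) => [|i r IH].
  by rewrite !big_nil scale1r.
by rewrite !big_cons IH (star_homZ (site_hom _ _)) -scalerAl -scalerAr scalerA.
Qed.

Lemma site_prod_sum (J : finType) (F : 'I_N -> J -> M3 R k.+1) :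
  site_prod (fun i => \sum_j F i j) =
  \sum_(f : {ffun 'I_N -> J}) site_prod (fun i => F i (f i)).
Proof.
rewrite /site_prod.
under eq_bigr do rewrite (star_hom_sum (site_hom _ _)).
by rewrite bigA_distr_bigA.
Qed.

Lemma alpha_site_prod h m :
  alpha h (site_prod m) = site_prod (fun i => Z2_action (@Ad_w R k.+1) (h i) (m i)).
Proof.
rewrite /site_prod (big_morph _ (star_homM (alpha_hom h)) (star_hom1 (alpha_hom h))).
by apply: eq_bigr => i _; rewrite (alpha_site Btensor Hnu nuE Atensor alphaE).
Qed.

Lemma site_prod_comm a m :
  (forall n (m' : M3 R k.+1), a * site n m' = site n m' * a) ->
  a * site_prod m = site_prod m * a.
Proof.
move=> ac; rewrite /site_prod.
elim/big_rec: _ => [|i y _ yE]; first by rewrite mulr1 mul1r.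
by rewrite mulrA ac -mulrA yE mulrA.
Qed.

Definition slot_char (s : {ffun 'I_N -> slot k.+1}) : {ffun 'I_N -> bool} :=
  [ffun i => slot_sign (s i)].

Definition slot_good (s : {ffun 'I_N -> slot k.+1}) : bool :=
  [forall i, s i != None].

Definition flip_by (h : Z2pow) (x : {ffun 'I_N -> bool}) : {ffun 'I_N -> bool} :=
  [ffun i : 'I_N => x i (+) odd (h i : 'Z_2)].

(** Both families are products over the copies of those in [position_units]: [E] diagonalizes the
    action, while [e x] picks block [x i] in copy i, so that h permutes these projections. The last
    clause will serve for elements of a level that does not reach position k. *)
Lemma top_units : exists (E : {ffun 'I_N -> slot k.+1} -> {ffun 'I_N -> slot k.+1} -> A)
    (e : {ffun 'I_N -> bool} -> A),
  [/\ matrix_units E,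
      forall h s t, alpha h (E s t) =
        (char_sign h (slot_char s) * char_sign h (slot_char t)) *: E s t,
      [/\ forall x, projection (e x),
          forall x y, x != y -> e x * e y = 0,
          \sum_x e x = \sum_(s | slot_good s) E s s &
          forall h x, alpha h (e x) = e (flip_by h x)] &
      forall a, (forall n (m : M3 R k.+1), a * site n m = site n m * a) ->
        (forall s t, a * E s t = E s t * a) /\ (forall x, a * e x = e x * a)].
Proof.
have [eps [e [U _ Uw [eS eM e1 ew]]]] := position_units R k.+1.
exists (fun s t => site_prod (fun i => eps (s i) (t i))).
exists (fun x => site_prod (fun i => e (x i))).
have prodb (T : finType) (s t : {ffun 'I_N -> T}) :
    \prod_i (s i == t i)%:R = (s == t)%:R :> R[i].
  have [->|st] := eqVneq s t; first by rewrite big1// => i _; rewrite eqxx.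
  have [i sti] : exists i, s i != t i.
    apply/existsP; rewrite -negb_forall; apply: contra st => /forallP h.
    by apply/eqP/ffunP => i; exact/eqP.
  by rewrite (bigD1 i)//= (negPf sti) mul0r.
have EU : matrix_units (fun s t : {ffun 'I_N -> slot k.+1} => site_prod (fun i => eps (s i) (t i))).
  split=> [s t u v|s t|].
  - rewrite site_prodM -prodb -site_prodZ; apply: eq_site_prod => i.
    by case: U => ->.
  - by rewrite site_prod_star; apply: eq_site_prod => i; rewrite (munit_star U).
  - by rewrite -(site_prod_sum (fun i s => eps s s)) (munit_sum1 U) site_prod1.
split=> //.
- move=> h s t; rewrite alpha_site_prod /char_sign -big_split -site_prodZ.
  apply: eq_site_prod => i /=; rewrite !ffunE -exprMn.
  rewrite /Z2_action; elim: (nat_of_ord (h i)) => [|j IH].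
    by rewrite expr0 scale1r.
  by rewrite iterS IH /Ad_w -scalerAr -scalerAl -/(Ad_w _) Uw scalerA exprSr.
- split=> [x|x y xy||h x].
  + split; first by rewrite site_prod_star; apply: eq_site_prod => i; rewrite eS.
    by rewrite site_prodM; apply: eq_site_prod => i; rewrite eM eqxx scale1r.
  + rewrite site_prodM -(scale0r (site_prod (fun i => e (x i)))).
    by rewrite -[0 in RHS]/(false%:R) -(negPf xy) -prodb -site_prodZ; apply: eq_site_prod => i; rewrite eM.
  + rewrite -(site_prod_sum (fun _ => e)).
    rewrite -[LHS]mulr1 -(munit_sum1 EU) mulr_sumr (bigID slot_good)/= addrC big1 ?add0r.
      apply: eq_bigr => s /forallP gs; rewrite site_prodM; apply: eq_site_prod => i.
      by rewrite e1 mulrBl mul1r (munitM0 U) ?subr0// eq_sym.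
    (* In a bad multi-index some factor is (1 - eps None None) * eps None None = 0. *)
    move=> s; rewrite negb_forall => /existsP[] i; rewrite negbK => /eqP si.
    rewrite site_prodM /site_prod.
    have z : site i ((\sum_b e b) * eps (s i) (s i)) = 0.
      by rewrite e1 si mulrBl mul1r (munitM U) subrr (star_hom0 (site_hom _ _)).
    have : forall r : seq 'I_N, i \in r -> \prod_(j <- r) site j ((\sum_b e b) * eps (s j) (s j)) = 0.
      elim=> // j r IH; rewrite inE big_cons => /orP[/eqP <-|/IH ->]; first by rewrite z mul0r.
      by rewrite mulr0.
    by apply; rewrite mem_index_enum.
  + rewrite alpha_site_prod; apply: eq_site_prod => i; rewrite ffunE /Z2_action.
    elim: (nat_of_ord (h i)) => [|j IH]; first by rewrite addbF.
    by rewrite iterS IH ew /= addbN.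
- by move=> a ac; split=> *; exact: site_prod_comm.
Qed.
End TopSites.

(** * Counting multi-indices *)

(** The elements with a given label are enumerated on both sides and matched by rank. *)
Lemma labelled_injection (X Y : finType) (L : eqType) (y0 : Y)
    (PX : pred X) (PY : pred Y) (lx : X -> L) (ly : Y -> L) :
  (forall l, #|[pred x | PX x & lx x == l]| <= #|[pred y | PY y & ly y == l]|)%N ->
  exists j : X -> Y, {in PX &, injective j} /\
    forall x, PX x -> PY (j x) /\ ly (j x) = lx x.
Proof.
move=> card_le; pose fx l := enum [pred x | PX x & lx x == l].
pose fy l := enum [pred y | PY y & ly y == l].
pose j x := nth y0 (fy (lx x)) (index x (fx (lx x))).
have jlt x : PX x -> (index x (fx (lx x)) < size (fy (lx x)))%N.
  move=> Px; rewrite /fy -cardE; apply: leq_trans (card_le _).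
  by rewrite cardE index_mem mem_enum inE Px eqxx.
have jP x : PX x -> PY (j x) /\ ly (j x) = lx x.
  move=> Px; have := mem_nth y0 (jlt x Px); rewrite mem_enum inE.
  by move=> /andP[-> /eqP].
exists j; split=> // x x' Px Px' jj; move: (Px : PX x) (Px' : PX x') => {}Px {}Px'.
have [_ e] := jP _ Px; have [_ e'] := jP _ Px'.
have lE : lx x = lx x' by rewrite -e -e' jj.
move: jj; rewrite /j -lE => /eqP.
have := jlt _ Px'; rewrite -lE => j'lt.
rewrite nth_uniq ?enum_uniq ?jlt// => /eqP.
move=> jj; apply: (index_inj x _ _ jj); rewrite mem_enum inE.
  by rewrite Px eqxx.
by rewrite lE Px' eqxx.
Qed.

(** A crude form of the binomial estimate; what matters is the exponent N - 1 of r in the error. *)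
Lemma expn_succ_double_le N r : (0 < r)%N ->
  ((r.*2.+1) ^ N <= r.*2 ^ N + N * 3 ^ N * r ^ N.-1)%N.
Proof.
move=> r0; elim: N => // -[|N IH]; first by rewrite !expn1; lia.
rewrite expnS; apply: leq_trans (leq_mul (leqnn _) IH) _.
rewrite mulnDr mulSn -addnA addnCA (expnS _ N.+1) leq_add2l [N.+2.-1]/= [N.+1.-1]/=.
have h1 : (r.*2 ^ N.+1 <= 3 ^ N.+2 * r ^ N.+1)%N.
  rewrite -muln2 expnMn mulnC leq_mul2r; apply/orP; right.
  by apply: (leq_trans (_ : _ <= 3 ^ N.+1)%N); rewrite ?leq_exp2r// leq_exp2l.
have h2 : (r.*2.+1 * (N.+1 * 3 ^ N.+1 * r ^ N) <= N.+1 * 3 ^ N.+2 * r ^ N.+1)%N.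
  rewrite [in leqRHS]expnS [(r ^ N.+1)%N]expnS.
  have -> : (N.+1 * (3 * 3 ^ N.+1) * (r * r ^ N) = 3 * r * (N.+1 * 3 ^ N.+1 * r ^ N))%N by ring.
  by rewrite leq_mul2r; apply/orP; right; lia.
have -> : (N.+2 * 3 ^ N.+2 * r ^ N.+1 = 3 ^ N.+2 * r ^ N.+1 + N.+1 * 3 ^ N.+2 * r ^ N.+1)%N by ring.
exact: leq_add.
Qed.

Lemma half_dim_ge k : (k <= half_dim k)%N.
Proof.
have h : (k.*2 < 3 ^ k)%N by elim: k => // k IH; rewrite expnS; lia.
rewrite /half_dim; apply: (leq_trans (_ : _ <= k.*2./2)%N).
  by rewrite doubleK.
by apply: half_leq; rewrite -ltnS prednK// expn_gt0.
Qed.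

Lemma card_slot k : #|{: slot k}| = (half_dim k).*2.+1.
Proof. by rewrite card_option card_prod card_bool card_ord muln2. Qed.

Lemma card_slot_bad N k :
  #|[pred s : {ffun 'I_N -> slot k.+1} | ~~ slot_good s]| =
  (((half_dim k.+1).*2.+1) ^ N - (half_dim k.+1).*2 ^ N)%N.
Proof.
have := cardC (@slot_good N k); rewrite card_ffun card_ord card_slot => <-.
have -> : #|@slot_good N k| = ((half_dim k.+1).*2 ^ N)%N.
  rewrite -[in RHS](card_ord N) -[(half_dim k.+1).*2]/((half_dim k.+1).*2.+1.-1).
  rewrite -card_slot (cardD1 None)/= -card_ffun_on; apply: eq_card => s.
  apply/forallP/ffun_onP => h i; have := h i; rewrite !inE ?andbT//.
by rewrite addKn; apply: eq_card.
Qed.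

Lemma card_slot_char N k (x : {ffun 'I_N -> bool}) :
  ((half_dim k.+1) ^ N <= #|[pred s : {ffun 'I_N -> slot k.+1} | slot_good s & slot_char s == x]|)%N.
Proof.
rewrite -[in leqLHS](card_ord N) -[X in (X ^ _)%N](card_ord (half_dim k.+1)) -card_ffun.
pose f (g : {ffun 'I_N -> 'I_(half_dim k.+1)}) : {ffun 'I_N -> slot k.+1} :=
  [ffun i => Some (g i, x i)].
have fi : injective f.
  by move=> g g' /ffunP gg; apply/ffunP => i; have := gg i; rewrite !ffunE => -[].
rewrite -(card_codom fi); apply: subset_leq_card; apply/fintype.subsetP => _ /codomP[g ->].
rewrite inE; apply/andP; split; first by apply/forallP => i; rewrite ffunE.
by apply/eqP/ffunP => i; rewrite !ffunE.
Qed.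

(* A multi-index is bad with a frequency that tends to 0 as k grows, while each
   character takes up about the fraction 2^-N of the good multi-indices. *)
Lemma slot_counting N d K : exists2 k, (K <= k)%N & forall x : {ffun 'I_N -> bool},
  (d * #|[pred s : {ffun 'I_N -> slot k.+1} | ~~ slot_good s]| <=
   #|[pred s : {ffun 'I_N -> slot k.+1} | slot_good s & slot_char s == x]|)%N.
Proof.
(* By [half_dim_ge] this makes r(k+1) at least d * N * 3^N, the factor that lifts r^(N-1) to r^N. *)
pose k := (K + d * (N * 3 ^ N))%N; exists k; first exact: leq_addr.
move=> x; apply: leq_trans (card_slot_char _ x); rewrite card_slot_bad.
have rk := half_dim_ge k.+1; move: (half_dim k.+1) rk => r rk.
have r0 : (0 < r)%N by exact: leq_trans rk.
apply: (leq_trans (_ : _ <= d * (N * 3 ^ N * r ^ N.-1))%N).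
  by rewrite leq_mul2l leq_subLR expn_succ_double_le// orbT.
case: N @k x rk => [|N] k x rk; first by rewrite !mul0n muln0.
rewrite mulnA [(r ^ N.+1)%N]expnS leq_mul2r; apply/orP; right.
by apply: leq_trans rk; rewrite leqW// leq_addl.
Qed.

(** The character asked of [j (a, s)] cancels x and those of a and s, so that a sum of matrix units
    along j can be invariant. Each class of good multi-indices has room for all d' copies of the bad
    ones, whatever their labels. *)
Lemma slot_injection N k d d' (chi : 'I_d' -> {ffun 'I_N -> bool}) x :
  (d' <= d)%N ->
  (forall x : {ffun 'I_N -> bool},
    (d * #|[pred s : {ffun 'I_N -> slot k.+1} | ~~ slot_good s]| <=
     #|[pred s : {ffun 'I_N -> slot k.+1} | slot_good s & slot_char s == x]|)%N) ->
  exists j : 'I_d' * {ffun 'I_N -> slot k.+1} -> {ffun 'I_N -> slot k.+1},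
    {in [pred y | ~~ slot_good y.2] &, injective j} /\
    forall a s, ~~ slot_good s -> slot_good (j (a, s)) /\
      slot_char (j (a, s)) = xor_ffun x (xor_ffun (chi a) (slot_char s)).
Proof.
move=> dd cnt.
have [|j [ji jP]] := @labelled_injection _ _ _ [ffun=> None]
  [pred y : 'I_d' * {ffun 'I_N -> slot k.+1} | ~~ slot_good y.2] (@slot_good N k)
  (fun y => xor_ffun x (xor_ffun (chi y.1) (slot_char y.2))) (@slot_char N k).
  move=> l; apply: leq_trans (cnt l).
  apply: (@leq_trans #|[pred y : 'I_d' * {ffun 'I_N -> slot k.+1} | ~~ slot_good y.2]|).
    by apply: subset_leq_card; apply/fintype.subsetP => y; rewrite !inE => /andP[].
  rewrite (_ : #|_| = d' * #|[pred s : {ffun 'I_N -> slot k.+1} | ~~ slot_good s]|)%N.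
    by rewrite leq_mul2r dd orbT.
  by rewrite -[d' in RHS]card_ord -cardX; apply: eq_card => y; rewrite !inE.
by exists j; split=> // a s bs; exact: (jP (a, s)).
Qed.

(** * Cuntz subequivalence *)

Section CuntzSubequivalence.
Context {R : realType} {A : cstarAlgType R}.

(** These two bounds suffice to squeeze the norms in [cuntz_sub] to 0 from estimates in A. *)
Lemma mxcnorm1_le (X : 'M[A]_1) : 0 <= mxcnorm X <= cnorm (X 0 0).
Proof.
have hE (xi : 'cV[A]_1) : hilb_norm xi = cnorm (xi 0 0).
  by rewrite /hilb_norm big_ord_recl big_ord0 addr0 cnorm_star sqrtr_sqr ger0_norm.
have ub : ubound [set hilb_norm (X *m xi) | xi in [set xi | hilb_norm xi <= 1]] (cnorm (X 0 0)).
  move=> _ [xi /=] + <-; rewrite !hE => xi1; rewrite mxE big_ord_recl big_ord0 addr0.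
  by apply: (le_trans (cnormM _ _)); rewrite -[leRHS]mulr1 ler_wpM2l.
have in0 : [set hilb_norm (X *m xi) | xi in [set xi | hilb_norm xi <= 1]] 0.
  by exists 0; rewrite /= ?mulmx0 hE mxE cnorm0// ler01.
apply/andP; split; last by apply: ge_sup => //; exists 0.
by apply: ub_le_sup => //; exists (cnorm (X 0 0)).
Qed.

Lemma padmx1 (X : 'M[A]_1) : padmx 1 X = X.
Proof.
by apply/matrixP => i j; rewrite mxE !ord1 !insubT//=; congr (X _ _); apply/val_inj.
Qed.

Lemma cuntz_sub1 (D : set A) (P y : A) (w : nat -> A) :
  (forall k, D (w k)) ->
  (fun k => cnorm (w k * y * star (w k) - P)) @ \oo --> (0 : R) ->
  cuntz_sub D (P%:M : 'M[A]_1) (y%:M : 'M[A]_1).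
Proof.
move=> Dw wP; exists (fun _ => 1%N); exists (fun k => (w k)%:M : 'M[A]_1); split.
  by move=> k i j; rewrite !ord1 mxE eqxx mulr1n.
pose F k := ((w k)%:M *m y%:M *m adjmx (w k)%:M - P%:M : 'M[A]_1).
apply: (squeeze_cvgr (f := fun=> 0) (h := fun k => cnorm (w k * y * star (w k) - P))).
- apply: nearW => k /=; rewrite !padmx1.
  have := mxcnorm1_le (F k).
  have -> // : F k 0 0 = w k * y * star (w k) - P.
  by rewrite !mxE !big_ord_recl !big_ord0 !mxE !big_ord_recl !big_ord0 !mxE/= !mulr1n !addr0.
- exact: cvg_cst.
- exact: wP.
Qed.

Definition star_subalgebra (D : set A) : Prop :=
  [/\ D 1,
      forall a b, D a -> D b -> D (a - b),
      forall a b, D a -> D b -> D (a * b),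
      forall a, D a -> D (star a) &
      forall (c : R[i]) a, D a -> D (c *: a)].

(* Newton's iteration for the inverse square root of [z y z^*] in [P A P]. *)
Lemma cuntz_sub_near (D : set A) (P y z : A) :
  star_subalgebra D -> D P -> D y -> D z ->
  projection P -> star y = y -> P * z = z ->
  cnorm (z * y * star z - P) <= 2^-1 ->
  cuntz_sub D (P%:M : 'M[A]_1) (y%:M : 'M[A]_1).
Proof.
move=> [D1 DB DM DS DZ] DP Dy Dz [sP PP] sy Pz zP.
pose hd (v : A) := (2^-1 : R)%:C *: (v * y * star v - P).
(* If w y w^* = P + 2h, then 1 - h is the inverse square root of 1 + 2h to first order, and the new
   error is 2h^3 - 3h^2. For h of norm at most 1/4 this at least halves the error. *)
pose w := fix w k := if k is k'.+1 then (1 - hd (w k')) * w k' else z.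
have hhE (v : A) : v * y * star v = P + (hd v + hd v).
  rewrite /hd -scalerDl -rmorphD/= (_ : 2^-1 + 2^-1 = 1 :> R); last lra.
  by rewrite scale1r addrC subrK.
have hdn (v : A) : cnorm (v * y * star v - P) = 2 * cnorm (hd v).
  by rewrite /hd cnormZr ger0_norm ?invr_ge0// mulrA divff ?mul1r.
have H k : [/\ D (w k), P * w k = w k & cnorm (hd (w k)) <= 2^-1 ^+ k.+2].
  elim: k => [|k [Dw Pw wn]].
    split=> //=; rewrite expr2; have := zP; rewrite hdn; lra.
  set v := w k in Dw Pw wn *; set h := hd v in wn *.
  have wE : w k.+1 = (1 - h) * v by [].
  have sh : star h = h.
    by rewrite /h /hd starZr starB !starM starK sP sy mulrA.
  have Ph : P * h = h by rewrite /h /hd -scalerAr mulrBr !mulrA Pw PP.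
  have hP : h * P = h by rewrite -{1}sh -sP -starM Ph sh.
  have Dh : D h by apply: (DZ); apply: (DB) => //; apply: (DM); [exact: DM|exact: DS].
  have step : w k.+1 * y * star (w k.+1) - P =
      (h * h * h + h * h * h) - h * h - (h * h + h * h).
    rewrite wE starM starB star1 sh !mulrA -(mulrA _ v) -(mulrA _ (v * y)) hhE -/h.
    have -> : (1 - h) * (P + (h + h)) = P + h - (h * h + h * h).
      by rewrite mulrBl mul1r !mulrDr hP opprD !addrA addrK.
    rewrite mulrBr mulr1 mulrBl mulrDl Ph mulrDl opprB addrAC.
    rewrite [P + h - _ - P]addrAC (addrC P h) addrK addrC (addrC h (h * h)).
    by rewrite (opprD (h * h) h) (addrA (h * h * h + h * h * h)) subrKA.
  split.
  - by rewrite wE; apply: (DM) => //; exact: DB.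
  - by rewrite wE mulrA mulrBr mulr1 Ph -[in X in X * v]hP -{1}[P]mul1r -mulrBl -mulrA Pw.
  - have eta : cnorm (hd (w k.+1)) <= 2^-1 * (2 * cnorm h ^+ 3 + 3 * cnorm h ^+ 2).
      rewrite -[leLHS](@mulKf _ 2)//; rewrite -hdn step; apply: ler_wpM2l; first by rewrite invr_ge0.
      have h2 : cnorm (h * h) <= cnorm h ^+ 2 by rewrite expr2 cnormM.
      have h3 : cnorm (h * h * h) <= cnorm h ^+ 3.
        by rewrite exprSr; apply: le_trans (cnormM _ _) _; rewrite ler_wpM2r.
      have := cnormB (h * h * h + h * h * h - h * h) (h * h + h * h).
      have := cnormB (h * h * h + h * h * h) (h * h).
      have := cnormD (h * h * h) (h * h * h); have := cnormD (h * h) (h * h).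
      lra.
    have w4 : cnorm h <= 4^-1.
      apply: (le_trans wn); rewrite !exprS mulrA.
      have : 2^-1 ^+ k <= 1 :> R by rewrite exprn_ile1 ?invr_ge0// invf_le1// ler1n.
      lra.
    apply: (le_trans eta); rewrite [leRHS]exprS; apply: ler_wpM2l; first by rewrite invr_ge0.
    apply: le_trans wn; rewrite !exprS expr0.
    have := cnorm_ge0 h; move: (cnorm h) w4 => x x4 x0.
    have : x * x <= x * 4^-1 by rewrite ler_wpM2l.
    have : x * (x * x) <= x * (x * 4^-1) by rewrite ler_wpM2l// ler_wpM2l.
    nra.
apply: (@cuntz_sub1 _ _ _ w); first by move=> k; case: (H k).
apply: (squeeze_cvgr (f := fun=> 0) (h := geometric 1 2^-1)).
- apply: nearW => k; rewrite cnorm_ge0/= hdn mul1r; case: (H k) => _ _.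
  rewrite !exprS; have : 0 <= 2^-1 ^+ k :> R by rewrite exprn_ge0// invr_ge0.
  lra.
- exact: cvg_cst.
- by apply: cvg_geometric; rewrite ger0_norm ?invr_ge0// invf_lt1// ltr1n.
Qed.
End CuntzSubequivalence.

Section FixedAlgebra.
Context {R : realType} {G : topologicalGroupType} {A : cstarAlgType R}.
Context (alpha : G -> A -> A) (Halpha : is_action alpha).
Local Notation D := (fixed_alg alpha).

Let ah g : star_hom (alpha g). Proof. by case: Halpha => /(_ g)[]. Qed.

Lemma fixed_star_subalgebra : star_subalgebra D.
Proof.
split=> [g|a b Da Db g|a b Da Db g|a Da g|c a Da g].
- exact: star_hom1.
- by rewrite (star_homB (ah g)) Da Db.
- by rewrite (star_homM (ah g)) Da Db.
- by rewrite (star_hom_star (ah g)) Da.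
- by rewrite (star_homZ (ah g)) Da.
Qed.
End FixedAlgebra.

(** * Uniform continuity on the group *)

Section CantorGroup.
Context {R : realType}.

Lemma Z2pow_cvg (T : Type) (F : set_system T) (FF : Filter F) (u : T -> Z2pow)
    (x : Z2pow) :
  (forall n, \forall t \near F, u t n = x n) -> u @ F --> x.
Proof.
move=> un; apply/cvg_sup => n A [_ [[B _ <-] Bx] BA].
have := un n; apply: filterS => t tx; apply: BA.
by rewrite /preimage/= tx.
Qed.

Definition agree (N : nat) (x y : Z2pow) := forall n, (n < N)%N -> x n = y n.

Lemma agree_near N (x : Z2pow) : \forall y \near x, agree N x y.
Proof.
elim: N => [|N IH]; first by apply: filterS (Z2pow_near x 0) => y _ n.
apply: filterS2 IH (Z2pow_near x N) => y xy yN n.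
by rewrite ltnS leq_eqVlt => /orP[/eqP ->|/xy].
Qed.

(** Otherwise there are points agreeing with x on ever more coordinates at which f stays away from f
    x; they converge to x, against continuity. *)
Lemma contfun_locally_cylinder (f : contfun R Z2pow) (x : Z2pow) (e : R) : 0 < e ->
  exists N, forall y, agree N x y -> complex.Re `|f x - f y| < e.
Proof.
move=> e0; apply: contrapT => H.
have {}H N : {y | agree N x y /\ ~ complex.Re `|f x - f y| < e}.
  apply: cid; apply: contrapT => HN; apply: H; exists N => y xy.
  by apply: contrapT => nfy; apply: HN; exists y.
pose y N := sval (H N).
have yx : y @ \oo --> x.
  apply: Z2pow_cvg => n; exists n.+1 => // N /= nN.
  by have [/(_ n nN)] := svalP (H N).
have /cont_predP fc := cf_cont f.
have fy : (f (y N) : (R[i] : numFieldType)) @[N --> \oo] --> (f x : (R[i] : numFieldType)).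
  by apply: (@cvg_comp _ _ _ y f _ _ _ yx); exact: fc.
have e0' : 0 < e%:C by rewrite ltcR.
have /cvgrPdist_lt/(_ _ e0')[N _ /(_ N (leqnn N))] := fy.
have [_ nlt] := svalP (H N); rewrite /= -Re_normE ltcR => lt; exact: nlt.
Qed.

Lemma contfun_cylinder (f : contfun R Z2pow) (e : R) : 0 < e ->
  exists N, forall x y, agree N x y -> complex.Re `|f x - f y| < e.
Proof.
move=> e0.
have cpt : compact [set: Z2pow].
  have := @tychonoff nat (fun _ => discrete_topology 'Z_2) (fun _ => setT).
  have -> : [set g : prod_topology (fun _ : nat => discrete_topology 'Z_2) |
      forall i, [set: discrete_topology 'Z_2] (g i)] = setT by apply/seteqP; split.
  by apply => _; apply: finite_compact; exact: finite_finset.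
have e2 : 0 < e / 2 by rewrite divr_gt0.
(* In this form of compactness, a property that holds for large N near each point holds for large N
   at all points. *)
have := (compact_near_coveringP _).1 cpt nat \oo
  (fun N x => forall y, agree N x y -> complex.Re `|f x - f y| < e).
move=> /(_ _)[x _|N _ HN].
  have [M HM] := contfun_locally_cylinder f x e2.
  exists ([set x' | agree M x x'], [set N | (M <= N)%N]).
    by split; [exact: agree_near|exists M].
  move=> [x' N] /= [xx' MN] y x'y; change (complex.Re `|f x' - f y| < e).
  have xy : agree M x y by move=> n nM; rewrite xx'// x'y//; exact: leq_trans MN.
  have : complex.Re `|f x' - f y| <= complex.Re `|f x - f x'| + complex.Re `|f x - f y|.
    rewrite -lecR rmorphD/= !Re_normE; rewrite (distrC (f x) (f x')).
    exact: ler_distD.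
  have := HM _ xx'; have := HM _ xy; lra.
by exists N => x y; apply: (HN N (leqnn N)).
Qed.

(** Up to an error of 1, f takes only its values at the finitely many representatives [emb x]. *)
Lemma contfun_bounded (f : contfun R Z2pow) :
  has_sup (range (fun g => complex.Re `|f g|)).
Proof.
split; first by exists (complex.Re `|f 1%g|); exists 1%g.
have [N HN] := contfun_cylinder f ltr01.
pose emb (x : {ffun 'I_N -> 'Z_2}) : Z2pow :=
  fun n => if insub n is Some i then x i else 0.
exists (1 + \sum_x complex.Re `|f (emb x)|) => _ [g _ <-].
pose x : {ffun 'I_N -> 'Z_2} := [ffun i : 'I_N => g i].
have gx : agree N g (emb x).
  by move=> n nN; rewrite /emb insubT ffunE.
have := HN _ _ gx.
have : complex.Re `|f g| <= complex.Re `|f g - f (emb x)| + complex.Re `|f (emb x)|.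
  by rewrite -lecR rmorphD/= !Re_normE -{1}[f g](subrK (f (emb x))) ler_normD.
have : complex.Re `|f (emb x)| <= \sum_x complex.Re `|f (emb x)|.
  by rewrite (bigD1 x)//= lerDl sumr_ge0// => ? _; exact: Re_norm_ge0.
lra.
Qed.

Lemma le_sup_norm (f : contfun R Z2pow) g : complex.Re `|f g| <= sup_norm f.
Proof. by apply: ub_le_sup; [case: (contfun_bounded f)|exists g]. Qed.

Lemma sup_norm_ge0 (f : contfun R Z2pow) : 0 <= sup_norm f.
Proof. exact: le_trans (Re_norm_ge0 _) (le_sup_norm f 1%g). Qed.
End CantorGroup.

(** * Partial isometries from injections of multi-indices *)

Section Isometries.
Context {R : realType} {A : starAlgType R[i]} {T : finType}.
Context (F : T -> T -> A) (FU : matrix_units F).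

Definition munit_sum (Q : pred T) : A := \sum_(s | Q s) F s s.

Lemma munit_sumMr Q s t : munit_sum Q * F s t = (Q s)%:R *: F s t.
Proof.
rewrite /munit_sum mulr_suml big_mkcond (bigD1 s)//= big1 ?addr0 => [|u us].
  by case: (Q s); rewrite ?scale1r ?scale0r// (munitM FU).
by case: ifP => // _; rewrite (munitM0 FU).
Qed.

Lemma munit_sum_star Q : star (munit_sum Q) = munit_sum Q.
Proof. by rewrite star_sum; apply: eq_bigr => s _; rewrite (munit_star FU). Qed.

Lemma munit_sumMl Q s t : F s t * munit_sum Q = (Q t)%:R *: F s t.
Proof.
rewrite -[LHS]starK starM munit_sum_star (munit_star FU) munit_sumMr.
rewrite starZ (munit_star FU); case: (Q t); rewrite ?rmorph0 ?rmorph1//.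
Qed.

Lemma munit_sum_idem Q : munit_sum Q * munit_sum Q = munit_sum Q.
Proof.
rewrite {2}/munit_sum mulr_sumr; apply: eq_bigr => s Qs.
by rewrite munit_sumMr Qs scale1r.
Qed.

Lemma munit_sumC Q : 1 - munit_sum Q = munit_sum (predC Q).
Proof. by rewrite -(munit_sum1 FU) (bigID Q)/= addrC addrK. Qed.

Context {I : finType} (E : I -> I -> A) (EU : matrix_units E).
Context (g : I -> A) (Q : pred T) (j : I * T -> T).
Hypothesis gE : forall a b, star (g a) * g b = E a b.
Hypothesis EF : forall a b s t, E a b * F s t = F s t * E a b.
Hypothesis jQ : {in [pred x | Q x.2] &, injective j}.

(* For [g a = v (delta_a)^*] this maps [delta_a (x) delta_s], for [s] in [Q], to
   [v (x) delta_(j (a, s))]; for a unit vector [v] it is thus a partial isometry. *)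
Definition shuffle : A := \sum_(x | Q x.2) g x.1 * F (j x) x.2.

(** The products [star (g a) * g b] do not vanish for a != b, so the orthogonality of distinct terms
    must come from the units F. Hence j has to be injective on pairs (a, s), and not only in s for
    each a. *)
Lemma shuffle_isometry : star shuffle * shuffle = munit_sum Q.
Proof.
rewrite /shuffle star_sum mulr_suml.
transitivity (\sum_(x : I * T | Q x.2) E x.1 x.1 * F x.2 x.2).
  apply: eq_bigr => x Qx; rewrite mulr_sumr (bigD1 x)//= big1 ?addr0 => [|y /andP[Qy yx]].
    by rewrite starM (munit_star FU) mulrA -(mulrA _ _ (g _)) gE -EF -mulrA (munitM FU).
  rewrite starM (munit_star FU) mulrA -(mulrA _ _ (g _)) gE -EF -mulrA (munitM0 FU) ?mulr0//.
  by apply: contra yx => /eqP /jQ -> //; rewrite inE.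
rewrite big_mkcond big_prod_type/= exchange_big /munit_sum [RHS]big_mkcond/=.
apply: eq_bigr => s _; case: ifP => Qs; last by rewrite big1.
by rewrite -mulr_suml (munit_sum1 EU) mul1r.
Qed.

Lemma shuffle_mulr : shuffle * munit_sum Q = shuffle.
Proof.
rewrite /shuffle mulr_suml; apply: eq_bigr => x Qx.
by rewrite -mulrA munit_sumMl Qx scale1r.
Qed.

Lemma shuffle_eigen (y : A) (c : R[i]) :
  (forall a, y * g a = c *: g a) -> y * shuffle = c *: shuffle.
Proof.
move=> yg; rewrite /shuffle mulr_sumr scaler_sumr; apply: eq_bigr => x _.
by rewrite mulrA yg scalerAl.
Qed.

Lemma shuffle_mull (Q' : pred T) : (forall x, Q x.2 -> Q' (j x)) ->
  (forall a, munit_sum Q' * g a = g a * munit_sum Q') ->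
  munit_sum Q' * shuffle = shuffle.
Proof.
move=> jQ' gQ'; rewrite /shuffle mulr_sumr; apply: eq_bigr => x Qx.
by rewrite mulrA gQ' -mulrA munit_sumMr jQ' ?scale1r.
Qed.

Lemma shuffle_fixed (f : A -> A) (cg : I -> R[i]) (cF : T -> R[i]) :
  star_hom f -> (forall a, f (g a) = cg a *: g a) ->
  (forall s t, f (F s t) = (cF s * cF t) *: F s t) ->
  (forall x, Q x.2 -> cg x.1 * (cF (j x) * cF x.2) = 1) -> f shuffle = shuffle.
Proof.
move=> fh fg fF c1; rewrite /shuffle (star_hom_sum fh); apply: eq_bigr => x Qx.
by rewrite (star_homM fh) fg fF -scalerAl -scalerAr scalerA c1// scale1r.
Qed.
End Isometries.

Section CuntzIsometry.
Context {R : realType} {A : cstarAlgType R}.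

Lemma isometry_conj_le (z a : A) : projection (star z * z) ->
  cnorm (star z * a * z) <= cnorm a.
Proof.
move=> /cnorm_isometry_le1 z1; apply: le_trans (cnormM _ _) _.
rewrite -[leRHS]mulr1; apply: ler_pM => //.
apply: le_trans (cnormM _ _) _; rewrite cnorm_starE -[leRHS]mul1r.
exact: ler_pM.
Qed.

Lemma isometry_near_eigen (y y0 z : A) (lam c : R) :
  c ^+ 2 = lam^-1 -> projection (star z * z) -> y0 * z = lam%:C *: z -> 0 < lam ->
  cnorm (y - y0) <= lam / 2 ->
  cnorm ((c%:C *: star z) * y * star (c%:C *: star z) - star z * z) <= 2^-1.
Proof.
move=> cc zP yz l0 yy.
have -> : (c%:C *: star z) * y * star (c%:C *: star z) - star z * z =
    lam^-1%:C *: (star z * (y - y0) * z).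
  rewrite starZr starK -!scalerAl -scalerAr scalerA -rmorphM/= -expr2 cc.
  rewrite mulrBr mulrBl scalerBr -(mulrA _ y0) yz -scalerAr scalerA -rmorphM/=.
  by rewrite mulVf ?gt_eqF// scale1r.
rewrite cnormZr gtr0_norm ?invr_gt0// ler_pdivrMl//.
exact: le_trans (isometry_conj_le _ zP) yy.
Qed.

(** On the range of z the element [y0] acts as lam, so compressing y by z / sqrt lam gives P up to
    an error of at most 1/2, where Newton's iteration can start. *)
Lemma cuntz_sub_isometry (D : set A) (P y y0 z : A) (lam : R) :
  star_subalgebra D -> D P -> D y -> D z ->
  projection P -> star z * z = P -> z * P = z -> star y = y ->
  y0 * z = lam%:C *: z -> 0 < lam -> cnorm (y - y0) <= lam / 2 ->
  cuntz_sub D (P%:M : 'M[A]_1) (y%:M : 'M[A]_1).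
Proof.
move=> DA DP Dy Dz PP zz zP sy yz l0 yy.
have [D1 DB DM DS DZ] := DA; have [sP _] := PP.
apply: (@cuntz_sub_near _ _ D P y ((Num.sqrt lam)^-1%:C *: star z)) => //.
- exact/DZ/DS.
- by rewrite -scalerAr -{1}sP -starM zP.
- rewrite -[X in _ - X]zz; apply: isometry_near_eigen yy => //; last by rewrite zz.
  by rewrite exprVn sqr_sqrtr// ltW.
Qed.

(** Compressing p x0 p by g gives lam times the projection [star g * g * p], whose norm is 1 because
    it is nonzero; replacing x0 by x costs at most their distance. *)
Lemma eigen_le_corner (x x0 p g : A) (lam : R) :
  projection p -> projection (star g * g) -> star g * g * p <> 0 ->
  p * g = g * p -> p * x0 = x0 * p -> x0 * g = lam%:C *: g -> 0 <= lam ->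
  lam <= cnorm (p * x * p) + cnorm (x - x0).
Proof.
move=> [sp pp] gP gp0 pg px xg l0.
have sgp : p * star g = star g * p by rewrite -[LHS]starK starM starK sp -pg starM sp.
have pE : p * (star g * g) = star g * g * p.
  by rewrite mulrA sgp -!mulrA pg.
have qP : projection (star g * g * p).
  case: gP => sG GG; split; first by rewrite starM sG sp pE.
  move: (star g * g) pE GG => H pH HH.
  by rewrite -mulrA (mulrA p) pH -(mulrA H p) pp mulrA HH.
have <- : cnorm (star g * (p * x0 * p) * g) = lam.
  rewrite px -(mulrA x0) pp -!mulrA pg (mulrA x0) xg -scalerAl -scalerAr mulrA.
  by rewrite cnormZr ger0_norm// cnorm_proj// mulr1.
have -> : star g * (p * x0 * p) * g =
    star g * (p * x * p) * g - star g * (p * (x - x0) * p) * g.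
  by rewrite -mulrBl -mulrBr -mulrBl -mulrBr opprB addrC subrK.
apply: le_trans (cnormB _ _) _; apply: lerD; first exact: isometry_conj_le.
apply: le_trans (isometry_conj_le _ gP) _.
have := @isometry_conj_le p (x - x0); rewrite sp pp; apply; by split.
Qed.

Lemma cnorm_square_near (b : A) (e : R) : 0 < e ->
  exists2 d, 0 < d & forall b0, cnorm (b - b0) <= d ->
    cnorm (star b * b - star b0 * b0) <= e.
Proof.
move=> e0; set n := cnorm b.
have n0 : 0 <= n by exact: cnorm_ge0.
(* The difference is at most d (n + cnorm b0), and d <= 1 gives cnorm b0 <= n + 1. *)
pose d := Num.min 1 (e / (2 * n + 1)).
have p1 : 0 < 2 * n + 1 by lra.
exists d; first by rewrite lt_min ltr01 divr_gt0.
move=> b0; rewrite le_min => /andP[h1]; rewrite ler_pdivlMr// => h2.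
have -> : star b * b - star b0 * b0 = star b * (b - b0) + star (b - b0) * b0.
  by rewrite starB mulrBr mulrBl addrA subrK.
have b0n : cnorm b0 <= n + 1.
  have := cnormB b (b - b0); rewrite subKr -/n; lra.
apply: le_trans (cnormD _ _) _.
have := cnormM (star b) (b - b0); have := cnormM (star (b - b0)) b0.
rewrite !cnorm_starE -/n.
have : cnorm (b - b0) * cnorm b0 <= cnorm (b - b0) * (n + 1) by rewrite ler_wpM2l.
move: h2; lra.
Qed.
End CuntzIsometry.

(** * The approximately equivariant maps *)

Section RokhlinMap.
Context {R : realType} {A : cstarAlgType R} (N : nat).
Context (e : {ffun 'I_N -> bool} -> A).
Hypothesis eP : forall x, projection (e x).
Hypothesis e0 : forall x y, x != y -> e x * e y = 0.
Local Notation CG := (contfun R Z2pow).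
Implicit Types f : CG.

(** Extension by 0 selects a representative of each cylinder of length N. *)
Definition embed_bits (x : {ffun 'I_N -> bool}) : Z2pow :=
  fun n => if insub n is Some i then (x i : nat)%:R : 'Z_2 else 0.

Definition rokhlin_map f : A := \sum_x f (embed_bits x) *: e x.

Let p := \sum_x e x.

Lemma rokhlin_map_mul f1 f2 :
  rokhlin_map (f1 * f2) = rokhlin_map f1 * rokhlin_map f2.
Proof.
rewrite /rokhlin_map mulr_suml; apply: eq_bigr => x _.
rewrite mulr_sumr (bigD1 x)//= big1 ?addr0 => [|y yx].
  by rewrite -scalerAl -scalerAr scalerA; case: (eP x) => _ ->.
by rewrite -scalerAl -scalerAr e0 1?eq_sym// !scaler0.
Qed.

Lemma rokhlin_map_linear : linear rokhlin_map.
Proof.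
move=> c f1 f2; rewrite /rokhlin_map scaler_sumr -big_split; apply: eq_bigr => x _ /=.
by rewrite scalerA -scalerDl.
Qed.

Lemma rokhlin_map_star f : rokhlin_map (star f) = star (rokhlin_map f).
Proof.
rewrite /rokhlin_map star_sum; apply: eq_bigr => x _; rewrite starZ.
by case: (eP x) => ->.
Qed.

Lemma rokhlin_map1 : rokhlin_map 1 = p.
Proof. by apply: eq_bigr => x _; rewrite scale1r. Qed.

Lemma rokhlin_map_sum (I : Type) (r : seq I) (F : I -> CG) :
  rokhlin_map (\sum_(i <- r) F i) = \sum_(i <- r) rokhlin_map (F i).
Proof.
elim: r => [|i r IH]; first by rewrite !big_nil /rokhlin_map big1// => x _; rewrite scale0r.
rewrite !big_cons -IH -[in LHS](scale1r (F i)) rokhlin_map_linear.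
by rewrite scale1r.
Qed.

(** The map is multiplicative and preserves the involution, so applied entrywise it sends Y^* Y to
    an element of the same form. *)
Lemma rokhlin_map_ucp : ucp p rokhlin_map.
Proof.
have corn f : corner p (rokhlin_map f).
  by rewrite /corner/= -rokhlin_map1 -!rokhlin_map_mul mul1r mulr1.
split=> //.
- exact: rokhlin_map_linear.
- exact: rokhlin_map1.
- move=> n X [Y _ ->]; exists (map_mx rokhlin_map Y).
    by move=> i j; rewrite mxE; exact: corn.
  apply/matrixP => i j; rewrite !mxE rokhlin_map_sum; apply: eq_bigr => k _.
  by rewrite rokhlin_map_mul !mxE rokhlin_map_star.
Qed.

Lemma rokhlin_map_contractive : contractive rokhlin_map.
Proof.
move=> f; apply: cnorm_orthogonal_sum => // [|x]; first exact: sup_norm_ge0.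
exact: le_sup_norm.
Qed.

Lemma embed_bits_translate (g : Z2pow) x :
  agree N (g^-1 * embed_bits x)%g (embed_bits (flip_by g x)).
Proof.
move=> n nN; rewrite /embed_bits !insubT/=.
rewrite ffunE -[LHS]/(- (g n : 'Z_2) + _) /embed_bits insubT/=.
set b := x _; move: (g n : 'Z_2) => /= -[[|[|//]] h]; apply/val_inj; by case: b.
Qed.

(** Translating a representative by g yields the representative of the flipped cylinder on the first
    N coordinates only; the other coordinates are absorbed by the small oscillation of f. *)
Lemma rokhlin_map_equivariant (alpha : Z2pow -> A -> A) f (d : R) :
  (forall g, star_hom (alpha g)) -> (forall g x, alpha g (e x) = e (flip_by g x)) ->
  (forall x y, agree N x y -> complex.Re `|f x - f y| < d) -> 0 <= d ->
  forall g, cnorm (rokhlin_map (Lt g f) - alpha g (rokhlin_map f)) <= d.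
Proof.
move=> ah ae fd d0 g.
have flipK : involutive (@flip_by N g).
  by move=> x; apply/ffunP => i; rewrite !ffunE addbK.
have -> : alpha g (rokhlin_map f) = \sum_x f (embed_bits (flip_by g x)) *: e x.
  rewrite /rokhlin_map (star_hom_sum (ah g)) [RHS](reindex_inj (inv_inj flipK)).
  by apply: eq_bigr => x _; rewrite (star_homZ (ah g)) ae flipK.
have -> : rokhlin_map (Lt g f) - \sum_x f (embed_bits (flip_by g x)) *: e x =
    \sum_x (f (g^-1 * embed_bits x)%g - f (embed_bits (flip_by g x))) *: e x.
  by rewrite /rokhlin_map -sumrB; apply: eq_bigr => x _; rewrite -scalerBl.
apply: cnorm_orthogonal_sum => // x.
by apply/ltW/fd; exact: embed_bits_translate.
Qed.

Lemma rokhlin_map_aecm (alpha : Z2pow -> A -> A) (F : set A) (S : set CG) (d : R) :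
  (forall g, star_hom (alpha g)) -> (forall g x, alpha g (e x) = e (flip_by g x)) ->
  0 < d ->
  (forall f, S f -> forall x y, agree N x y -> complex.Re `|f x - f y| < d / 2) ->
  (forall f a, S f -> F a -> exists2 a0, (forall x, a0 * e x = e x * a0) &
     2 * sup_norm f * cnorm (a - a0) < d) ->
  approx_equivariant_central_multiplicative alpha F S d rokhlin_map.
Proof.
move=> ah ae d0 Sd FS; split.
- by move=> f1 f2 _ _; rewrite rokhlin_map_mul subrr cnorm0.
- move=> f a Sf Fa; have [a0 a0e lt] := FS _ _ Sf Fa.
  have comm : rokhlin_map f * a0 = a0 * rokhlin_map f.
    rewrite /rokhlin_map mulr_suml mulr_sumr; apply: eq_bigr => x _.
    by rewrite -scalerAl -scalerAr a0e.
  have -> : rokhlin_map f * a - a * rokhlin_map f =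
      rokhlin_map f * (a - a0) - (a - a0) * rokhlin_map f.
    by rewrite mulrBr mulrBl comm opprB addrA subrK.
  apply: le_lt_trans lt; apply: le_trans (cnormB _ _) _.
  have := cnormM (rokhlin_map f) (a - a0); have := cnormM (a - a0) (rokhlin_map f).
  have : cnorm (rokhlin_map f) * cnorm (a - a0) <= sup_norm f * cnorm (a - a0).
    by rewrite ler_wpM2r// rokhlin_map_contractive.
  rewrite (mulrC (cnorm (a - a0)) (cnorm (rokhlin_map f))); lra.
(* A supremum of numbers below d could equal d; the bound d / 2 keeps the inequality strict. *)
- move=> f Sf; apply: (@le_lt_trans _ _ (d / 2)%:E); last first.
    by rewrite lte_fin; lra.
  apply: ge_ereal_sup => _ [g _ <-]; rewrite lee_fin.
  apply: rokhlin_map_equivariant => //; first exact: Sd.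
  by rewrite divr_ge0// ltW.
Qed.
End RokhlinMap.

(** * Averaging a level over the group *)

Section Averaging.
Context {R : realType} {A : cstarAlgType R} (alpha : Z2pow -> A -> A).
Hypothesis alpha_hom : forall h, star_hom (alpha h).
Context (N d : nat) (E : 'I_d -> 'I_d -> A) (chi : 'I_d -> {ffun 'I_N -> bool}).
Hypothesis alphaE : forall h s t,
  alpha h (E s t) = (char_sign h (chi s) * char_sign h (chi t)) *: E s t.

(** The action multiplies entry (i, j) by the product of the characters of i and j. Keeping the
    entries whose characters agree on r is thus the conditional expectation onto the fixed points of
    the subgroup generated by the coordinates in r. *)
Definition mask_char (r : seq 'I_N) (X : 'M[R[i]]_d) : 'M[R[i]]_d :=
  \matrix_(i, j) (if all (fun n => chi i n == chi j n) r then X i j else 0).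

Let unit_at (n : 'I_N) : Z2pow := fun m => (if m == n :> nat then 1 else 0 : 'Z_2).

Let char_sign_unit (n : 'I_N) (x : {ffun 'I_N -> bool}) :
  char_sign (unit_at n) x = (-1) ^+ x n :> R[i].
Proof.
rewrite /char_sign (bigD1 n)//= big1 ?mulr1 => [|m mn].
  by rewrite /unit_at eqxx expr1.
by rewrite /unit_at (_ : (m == n :> nat) = false) ?expr0//; apply: contraNF mn => /eqP/val_inj ->.
Qed.

(* Masking a further coordinate is averaging over the subgroup it generates. *)
Lemma mask_char_near (a : A) (X : 'M[R[i]]_d) (e : R) r :
  fixed_alg alpha a -> cnorm (a - mx_elem E X) <= e ->
  cnorm (a - mx_elem E (mask_char r X)) <= e.
Proof.
move=> Da aX; elim: r => [|n r IH].
  by rewrite (_ : mask_char [::] X = X)//; apply/matrixP => i j; rewrite mxE.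
set b := mx_elem E (mask_char r X) in IH.
have -> : mx_elem E (mask_char (n :: r) X) = (2^-1 : R)%:C *: (b + alpha (unit_at n) b).
  rewrite /b /mx_elem (star_hom_sum (alpha_hom _)) -big_split scaler_sumr.
  apply: eq_bigr => i _ /=.
  rewrite (star_hom_sum (alpha_hom _)) -big_split scaler_sumr; apply: eq_bigr => j _ /=.
  rewrite (star_homZ (alpha_hom _)) alphaE scalerA -scalerDl scalerA; congr (_ *: _).
  rewrite !char_sign_unit !mxE/= -signr_addb.
  have half : (2^-1 : R)%:C * (1 + 1) = 1 :> R[i].
    by rewrite -[1 + 1](rmorph_nat (real_complex R) 2) -rmorphM/= mulVf// pnatr_eq0.
  case: (all _ r); last by rewrite andbF !(mul0r, mulr0, addr0).
  have xx : (2^-1 : R)%:C * (X i j + X i j) = X i j.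
    by rewrite -[X in X + X]mulr1 -mulrDr mulrCA half mulr1.
  by case: (chi i n); case: (chi j n);
    rewrite /= ?expr0 ?expr1 ?mulr1 ?mulrN1 ?subrr ?mulr0 ?xx.
set b' := alpha _ b.
have -> : a - (2^-1 : R)%:C *: (b + b') = (2^-1 : R)%:C *: ((a - b) + (a - b')).
  rewrite addrACA -opprD scalerBr; congr (_ - _).
  rewrite -[X in _ *: (X + X)]scale1r -scalerDl scalerA.
  rewrite -[1 + 1](rmorph_nat (real_complex R) 2) -rmorphM/= mulVf ?pnatr_eq0//.
  by rewrite rmorph1 scale1r.
have ab' : cnorm (a - b') <= cnorm (a - b).
  rewrite -{1}(Da (unit_at n)) -(star_homB (alpha_hom _)).
  exact: star_hom_contractive.
rewrite cnormZr ger0_norm ?invr_ge0//.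
have := cnormD (a - b) (a - b'); lra.
Qed.

Lemma mask_charP (X : 'M[R[i]]_d) i j :
  mask_char (enum 'I_N) X i j != 0 -> chi i = chi j.
Proof.
rewrite mxE; case: ifP => [/allP h _|_]; last by rewrite eqxx.
by apply/ffunP => n; apply/eqP/h; rewrite mem_enum.
Qed.
End Averaging.

Lemma common_cylinder (R : realType) (s : seq (contfun R Z2pow)) (e : R) : 0 < e ->
  exists N, forall f, f \in s -> forall x y, agree N x y -> complex.Re `|f x - f y| < e.
Proof.
move=> e0; elim: s => [|f s [N IH]]; first by exists 0%N.
have [M HM] := contfun_cylinder f e0.
exists (maxn M N) => f'; rewrite inE => /orP[/eqP ->|f's] x y xy.
  by apply: HM => n nM; apply: xy; rewrite leq_max nM.
by apply: IH => // n nN; apply: xy; rewrite leq_max nN orbT.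
Qed.

Lemma le_sum_seq (R : realType) (T : eqType) (s : seq T) (F : T -> R) x :
  (forall y, 0 <= F y) -> x \in s -> F x <= \sum_(y <- s) F y.
Proof.
move=> F0 xs; rewrite (perm_big _ (perm_to_rem xs)) big_cons lerDl.
exact: sumr_ge0.
Qed.

(** * The common choice of p, phi and s *)

Section Main.
Context {R : realType}.
Context (B : cstarAlgType R) (iB : forall k : nat, M3 R k.+1 -> B).
Hypothesis Btensor : infinite_tensor (D := fun k => M3 R k.+1) iB.
Context (nu : B -> B) (Hnu : star_aut nu).
Hypothesis nuE : forall (N : nat) (m : forall k, M3 R k.+1),
  nu (elem_tensor (D := fun k => M3 R k.+1) iB N m) =
  elem_tensor (D := fun k => M3 R k.+1) iB N (fun k => Ad_w (m k)).
Context (A : cstarAlgType R) (iA : nat -> B -> A).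
Hypothesis Atensor : infinite_tensor (D := fun _ => B) iA.
Context (alpha : Z2pow -> A -> A) (Halpha : is_action alpha).
Hypothesis alphaE : forall (h : Z2pow) (N : nat) (b : nat -> B),
  alpha h (elem_tensor (D := fun _ => B) iA N b) =
  elem_tensor (D := fun _ => B) iA N (fun n => Z2_action nu (h n) (b n)).

Lemma common_level (s : seq A) (e : R) : 0 < e ->
  exists N K, forall a, a \in s ->
    exists2 a0, finite_level iB iA N K a0 & cnorm (a - a0) < e.
Proof.
move=> e0; elim: s => [|a s [N [K IH]]]; first by exists 0%N, 0%N.
have [N' [K' [a0 [la0 aa0]]]] := finite_level_dense Btensor Atensor a e0.
exists (maxn N' N), (maxn K' K) => b; rewrite inE => /orP[/eqP ->|/IH[b0 lb0 bb0]].
  by exists a0 => //; apply: finite_levelS la0; exact: leq_maxl.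
by exists b0 => //; apply: finite_levelS lb0; exact: leq_maxr.
Qed.

Lemma rokhlin_common_choice (F : set A) (S : set (contfun R Z2pow)) (eps : R) (x y : A) :
  finite_set F -> finite_set S -> 0 < eps ->
  pos setT x -> cnorm x = 1 ->
  pos (fixed_alg alpha) y -> y <> 0 ->
  exists (p : A) (phi : contfun R Z2pow -> A),
    [/\ projection p, fixed_alg alpha p, ucp p phi,
        trp_comparison_conditions alpha F S eps x y p phi &
        exists s : A,
          [/\ partial_isometry s, fixed_alg alpha s, contractive phi &
              strong_modified_conditions alpha F S eps x s p phi]].
Proof.
move=> finF finS eps0 [bx _ xE] x1 [bY DbY yE] y0.
have ah := alpha_hom Halpha.
have [sF FE] := (finite_seqP F).1 finF; have [sS SE] := (finite_seqP S).1 finS.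
have inF a : F a -> a \in sF by rewrite FE.
have inS f : S f -> f \in sS by rewrite SE.
have ny := cnorm_gt0 y0.
pose M := 1 + \sum_(f <- sS) sup_norm f.
have M1 : 1 <= M by rewrite lerDl sumr_ge0// => f _; exact: sup_norm_ge0.
have SM f : S f -> sup_norm f <= M.
  move=> /inS fS; have := le_sum_seq (@sup_norm_ge0 R) fS; rewrite /M; lra.
(* The eigenvalue lam will be at least 1 - dx. The bound 1/4 gives dx <= lam / 2 for the Cuntz
   comparison, and eps / 4 gives lam - dx >= 1 - 2 dx > 1 - eps for the norm of p x p. *)
pose dx := Num.min (4^-1) (eps / 4).
have dx0 : 0 < dx by rewrite lt_min invr_gt0 ltr0n divr_gt0.
have [tx tx0 Htx] := cnorm_square_near bx dx0.
(* Then mu >= 3/4 cnorm y, and the error cnorm y / 4 is below mu / 2. *)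
have dy0 : 0 < cnorm y / 4 by rewrite divr_gt0.
have [ty ty0 Hty] := cnorm_square_near bY dy0.
(* The first bound makes the commutators of phi f and of s with F small, since M dominates both
   [sup_norm f] and 1; the others serve the factors of x and y. *)
pose eta := Num.min (eps / (4 * M)) (Num.min tx ty).
have M4 : 0 < 4 * M by lra.
have eta0 : 0 < eta by rewrite !lt_min tx0 ty0 !divr_gt0.
have [N1 HN1] := common_cylinder sS (divr_gt0 eps0 (ltr0Sn R 1)).
have [N2 [K HK]] := common_level (bx :: bY :: sF) eta0.
(* One N serves both the oscillation of the functions in S and the level approximating the data. *)
pose N := maxn N1 N2.
have {}HK a : a \in bx :: bY :: sF ->
    exists2 a0, finite_level iB iA N K a0 & cnorm (a - a0) < eta.
  move=> /HK[a0 la aa]; exists a0 => //; apply: finite_levelS la => //; exact: leq_maxr.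
have {}HN1 f : S f -> forall x y, agree N x y -> complex.Re `|f x - f y| < eps / 2.
  by move=> /inS fS u v uv; apply: HN1 => // n nN; apply: uv; rewrite leq_max nN.
have [d [E [chi [EU Ea Ec Espan]]]] :=
  level_matrix_units Btensor Hnu nuE Atensor Halpha alphaE N K.
have [bx0 lx nx] := HK bx (mem_head _ _).
have [by0 ly nby] := HK bY (mem_behead (s := bx :: bY :: sF) (mem_head _ _)).
have [X XE] := Espan _ lx; have [Y YE] := Espan _ ly.
pose Y' := mask_char chi (enum 'I_N) Y.
have nY : cnorm (bY - mx_elem E Y') <= ty.
  apply: mask_char_near => //; rewrite -YE ltW//; apply: (lt_le_trans nby).
  by rewrite /eta !ge_min lexx !orbT.
have nX : cnorm (bx - mx_elem E X) <= tx.
  by rewrite -XE ltW//; apply: (lt_le_trans nx); rewrite /eta !ge_min lexx orbT.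
have {}Htx := Htx _ nX; have {}Hty := Hty _ nY.
rewrite -xE in Htx; rewrite -yE in Hty.
(* The comparison with x takes place in A, so a single block is used; for y below, the blocks are
   the classes of the characters. *)
have [//|v [lam [_ [v1 vX Xlam _]]]] :=
  @top_eigenvector _ _ _ _ EU _ (fun _ => tt) X.
have [|w [mu [l [w1 wY Ymu wl]]]] := @top_eigenvector _ _ _ _ EU _ chi Y'.
  exact: mask_charP.
(* The count covers the d columns of the maps z below and the single column of s. *)
have [k Kk cnt] := slot_counting N (maxn d 1) K.
have [T0 [e [TU Ta [eP e0 esum ea] Tcomm]]] :=
  @top_units _ _ _ Btensor _ Hnu nuE _ _ Atensor _ Halpha alphaE N k.
pose good := @slot_good N k; pose bad := predC good.
pose p := munit_sum T0 good.
have pP : projection p by split; [exact: munit_sum_star|exact: munit_sum_idem].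
have qE : 1 - p = munit_sum T0 bad by exact: munit_sumC.
have qP : projection (1 - p).
  by rewrite qE; split; [exact: munit_sum_star|exact: munit_sum_idem].
have site_comm_top a n (m : M3 R k.+1) : finite_level iB iA N K a ->
    a * site iB iA n m = site iB iA n m * a.
  exact: finite_level_comm.
have ET a b s t : E a b * T0 s t = T0 s t * E a b.
  by apply: (Tcomm (E a b) _).1 => n m; exact: Ec.
have Ep a b : E a b * p = p * E a b.
  by rewrite mulr_sumr mulr_suml; apply: eq_bigr => s _; exact: ET.
have Xp Z : mx_elem E Z * p = p * mx_elem E Z.
  rewrite [LHS]mulr_suml [RHS]mulr_sumr; apply: eq_bigr => i _.
  rewrite [LHS]mulr_suml [RHS]mulr_sumr; apply: eq_bigr => j _.
  by rewrite -scalerAl -scalerAr Ep.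
have gp (u : 'cV[R[i]]_d) a : p * vec_elem E u a = vec_elem E u a * p.
  rewrite [RHS]mulr_suml [LHS]mulr_sumr; apply: eq_bigr => i _.
  by rewrite -scalerAl -scalerAr Ep.
have gE (u : 'cV[R[i]]_d) : \sum_i Num.conj (u i 0) * u i 0 = 1 ->
    forall a b, star (vec_elem E u a) * vec_elem E u b = E a b.
  by move=> u1 a b; rewrite star_vec_elemM// u1 scale1r.
have eigen Z (u : 'cV[R[i]]_d) c : map_mx Num.conj Z^T *m Z *m u = c%:C *: u ->
    forall a, star (mx_elem E Z) * mx_elem E Z * vec_elem E u a = c%:C *: vec_elem E u a.
  by move=> Zu a; rewrite mx_elem_star// mx_elemM// mx_elemM_vec// Zu vec_elemZ.
have [j [jinj jP]] := slot_injection chi l (leq_maxl d 1) cnt.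
have [j1 [j1inj j1P]] :=
  slot_injection (fun _ : 'I_1 => [ffun=> false]) [ffun=> false] (leq_maxr d 1) cnt.
(* With the trivial 1 by 1 system in place of the level, s involves only position k and so commutes
   with the whole level. *)
pose s := shuffle T0 (fun _ : 'I_1 => 1) bad j1.
have ss : star s * s = 1 - p.
  rewrite qE; apply: (shuffle_isometry TU munits_trivial) => // *.
    by rewrite star1 mulr1.
  by rewrite mul1r mulr1.
have sq : s * (1 - p) = s by rewrite qE; exact: (shuffle_mulr TU).
have ps : p * s = s.
  apply: (shuffle_mull TU) => [[i t] /= /(j1P i)[]//|i].
  by rewrite mulr1 mul1r.
have p_neq0 : p <> 0.
  move=> p0; have /eqP := ss; rewrite -ps p0 mul0r mulr0 subr0 eq_sym.
  by rewrite oner_eq0.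
have Ds : fixed_alg alpha s.
  move=> h; apply: (shuffle_fixed (cg := fun _ => 1)
    (cF := fun t => char_sign h (slot_char t)) (ah h)) => //.
    by move=> i; rewrite (star_hom1 (ah h)) scale1r.
  move=> [i t] /= /(j1P i)[_ ->]; rewrite !char_sign_xor !char_sign_false !mul1r.
  exact: char_sign_sqr.
have Dp : fixed_alg alpha p.
  move=> h; rewrite /p (star_hom_sum (ah h)); apply: eq_bigr => t _.
  by rewrite Ta char_sign_sqr scale1r.
have Dq : fixed_alg alpha (1 - p).
  by move=> h; rewrite (star_homB (ah h)) (star_hom1 (ah h)) Dp.
pose z (u : 'cV[R[i]]_d) := shuffle T0 (vec_elem E u) bad j.
have zz (u : 'cV[R[i]]_d) : \sum_i Num.conj (u i 0) * u i 0 = 1 -> star (z u) * z u = 1 - p.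
  by move=> u1; rewrite qE; apply: (shuffle_isometry TU EU) => //; exact: gE.
have zq u : z u * (1 - p) = z u by rewrite qE; exact: (shuffle_mulr TU).
have Dz : fixed_alg alpha (z w).
  move=> h; apply: (shuffle_fixed
    (cg := fun a => char_sign h l * char_sign h (chi a))
    (cF := fun t => char_sign h (slot_char t)) (ah h)) => //.
    move=> a; rewrite /vec_elem (star_hom_sum (ah h)) scaler_sumr; apply: eq_bigr => i _.
    rewrite (star_homZ (ah h)) Ea; have [->|/wl ->] := eqVneq (w i 0) 0.
      by rewrite !scale0r scaler0.
    by rewrite !scalerA mulrC.
  (* Each of the characters of l, a and t now occurs twice, hence cancels. *)
  move=> [a t] /= /(jP a)[_ ->]; rewrite !char_sign_xor.
  rewrite -[_ * _ * char_sign h (slot_char t)]mulrA.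
  rewrite -[_ * _ * char_sign h (slot_char t)]mulrA char_sign_sqr mulr1.
  by rewrite mulrACA !char_sign_sqr mulr1.
have lam_ge : 1 - dx <= lam.
  apply: le_trans Xlam; rewrite -cnorm_star.
  have := cnormD (x - star (mx_elem E X) * mx_elem E X) (star (mx_elem E X) * mx_elem E X).
  rewrite subrK x1; lra.
have mu_ge : 3 / 4 * cnorm y <= mu.
  apply: le_trans Ymu; rewrite -cnorm_star.
  have := cnormD (y - star (mx_elem E Y') * mx_elem E Y') (star (mx_elem E Y') * mx_elem E Y').
  rewrite subrK; lra.
have dx4 : dx <= 4^-1 by rewrite /dx ge_min lexx.
have dxe : dx <= eps / 4 by rewrite /dx ge_min lexx orbT.
have subx : cuntz_sub setT ((1 - p)%:M : 'M[A]_1) (x%:M : 'M[A]_1).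
  apply: (@cuntz_sub_isometry _ _ setT _ _ (star (mx_elem E X) * mx_elem E X) (z v) lam) => //.
  - exact: zz.
  - by rewrite xE starM starK.
  - by apply: shuffle_eigen => a; exact: eigen.
  - lra.
  - by apply: (le_trans Htx); lra.
have suby : cuntz_sub (fixed_alg alpha) ((1 - p)%:M : 'M[A]_1) (y%:M : 'M[A]_1).
  have fixedA := fixed_star_subalgebra Halpha.
  apply: (@cuntz_sub_isometry _ _ (fixed_alg alpha) _ _
    (star (mx_elem E Y') * mx_elem E Y') (z w) mu) => //.
  - by rewrite yE; case: fixedA => _ _ DM DS _; apply: DM => //; exact: DS.
  - exact: zz.
  - by rewrite yE starM starK.
  - by apply: shuffle_eigen => a; exact: eigen.
  - lra.
  - by apply: (le_trans Hty); lra.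
have subp : cuntz_sub (fixed_alg alpha) ((1 - p)%:M : 'M[A]_1) (p%:M : 'M[A]_1).
  have fixedA := fixed_star_subalgebra Halpha.
  apply: (@cuntz_sub_isometry _ _ (fixed_alg alpha) _ p p s 1) => //.
  - by case: pP.
  - by rewrite ps scale1r.
  - by rewrite subrr cnorm0; lra.
have [a0 _] := munit_ex EU.
have corner_x : 1 - eps < cnorm (p * x * p).
  have px0 : p * (star (mx_elem E X) * mx_elem E X) =
      star (mx_elem E X) * mx_elem E X * p.
    by rewrite mx_elem_star// mulrA -Xp -!mulrA Xp.
  have Eaa : star (vec_elem E v a0) * vec_elem E v a0 = E a0 a0 by exact: gE.
  have := @eigen_le_corner _ _ x (star (mx_elem E X) * mx_elem E X) p (vec_elem E v a0) lam pP.
  rewrite Eaa => /(_ (munit_proj _ EU) (munit_mul_neq0 EU Ep p_neq0) (gp _ _)).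
  move=> /(_ px0 (eigen _ _ _ vX a0)).
  have lam0 : 0 <= lam by lra.
  move=> /(_ lam0); lra.
have near a : F a -> exists2 a1, finite_level iB iA N K a1 & 4 * M * cnorm (a - a1) < eps.
  move=> /inF aF; have [|a1 la1 aa1] := HK a; first by rewrite !inE aF !orbT.
  exists a1 => //; rewrite mulrC -ltr_pdivlMr//; apply: (lt_le_trans aa1).
  by rewrite /eta ge_min lexx.
have aecm : approx_equivariant_central_multiplicative alpha F S eps (rokhlin_map e).
  apply: rokhlin_map_aecm => // f a Sf Fa; have [a1 la1 aa1] := near a Fa.
  exists a1 => [t|].
    by apply: (Tcomm a1 _).2 => n m; exact: site_comm_top.
  have := SM _ Sf; have := cnorm_ge0 (a - a1) => na fM.
  have := ler_wpM2r na fM; have := mulr_ge0 (sup_norm_ge0 f) na; lra.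
have phi_ucp : ucp p (rokhlin_map e).
  by have := rokhlin_map_ucp eP e0; rewrite esum.
exists p, (rokhlin_map e).
split; [exact: pP|exact: Dp|exact: phi_ucp| |exists s].
  by split; [exact: aecm|exact: subx|exact: suby|exact: subp|exact: corner_x].
split; [|exact: Ds|exact: rokhlin_map_contractive|].
  by rewrite /partial_isometry -mulrA ss.
split; [exact: aecm|exact: subx| | |exact: corner_x].
- split; first exact: ss.
  (* As the range of s lies below p, this difference is a projection and hence its own square. *)
  exists (p - s * star s); first by [].
  have ssp : s * star s * p = s * star s.
    by rewrite -mulrA -[X in star s * X](pP.1) -starM ps.
  have pss : p * (s * star s) = s * star s by rewrite mulrA ps.
  have ssss : s * star s * (s * star s) = s * star s.
    by rewrite mulrA -(mulrA s) ss sq.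
  rewrite starB starM starK pP.1 mulrBr !mulrBl pP.2 ssp pss ssss.
  by rewrite subrr subr0.
- move=> a Fa; have [a1 la1 aa1] := near a Fa.
  have sa1 : s * a1 = a1 * s.
    rewrite /s /shuffle mulr_suml mulr_sumr; apply: eq_bigr => t _.
    by rewrite !mul1r; apply/esym/(Tcomm a1 _).1 => n m; exact: site_comm_top.
  have -> : s * a - a * s = s * (a - a1) - (a - a1) * s.
    by rewrite mulrBr mulrBl sa1 opprB addrA subrK.
  have s1 : cnorm s <= 1 by apply: cnorm_isometry_le1; rewrite ss.
  apply: le_lt_trans (cnormB _ _) _.
  have na := cnorm_ge0 (a - a1).
  have := cnormM s (a - a1); have := cnormM (a - a1) s.
  have := ler_wpM2r na s1; have := ler_wpM2l na s1.
  have := ler_wpM2r na M1; lra.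
Qed.
End Main.

Theorem theorem7p5 (R : realType)
  (* B is the tensor product of the M_{3^k}, k >= 1, and nu that of the Ad(w_k) *)
  (B : cstarAlgType R) (iB : forall k : nat, M3 R k.+1 -> B)
  (Btensor : infinite_tensor (D := fun k => M3 R k.+1) iB)
  (nu : B -> B) (Hnu : star_aut nu)
  (nuE : forall (N : nat) (m : forall k, M3 R k.+1),
     nu (elem_tensor (D := fun k => M3 R k.+1) iB N m) =
     elem_tensor (D := fun k => M3 R k.+1) iB N (fun k => Ad_w (m k)))
  (* A is the tensor product of countably many copies of B *)
  (A : cstarAlgType R) (iA : nat -> B -> A)
  (Atensor : infinite_tensor (D := fun _ => B) iA)
  (alpha : Z2pow -> A -> A) (Halpha : is_action alpha)
  (alphaE : forall (h : Z2pow) (N : nat) (b : nat -> B),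
     alpha h (elem_tensor (D := fun _ => B) iA N b) =
     elem_tensor (D := fun _ => B) iA N (fun n => Z2_action nu (h n) (b n))) :
  [/\ tracial_rokhlin_comparison alpha,
      strong_modified_tracial_rokhlin alpha &
      forall (F : set A) (S : set (contfun R Z2pow)) (eps : R) (x y : A),
        finite_set F -> finite_set S -> 0 < eps ->
        pos setT x -> cnorm x = 1 ->
        pos (fixed_alg alpha) y -> y <> 0 ->
        exists (p : A) (phi : contfun R Z2pow -> A),
          [/\ projection p, fixed_alg alpha p, ucp p phi,
              trp_comparison_conditions alpha F S eps x y p phi &
              exists s : A,
                [/\ partial_isometry s, fixed_alg alpha s, contractive phi &
                    strong_modified_conditions alpha F S eps x s p phi]]].
Proof.
have core := rokhlin_common_choice Btensor Hnu nuE Atensor Halpha alphaE.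
split=> // [F S eps x y finF finS eps0 px x1 py y0|F S eps x finF finS eps0 px x1].
  have [p [phi [pP Dp up tc _]]] := core F S eps x y finF finS eps0 px x1 py y0.
  by exists p, phi.
(* The strong modified property involves no y, so the common choice is made with y = 1. *)
have p1 : pos (fixed_alg alpha) 1.
  exists 1; last by rewrite star1 mulr1.
  by case: (fixed_star_subalgebra Halpha).
have [|p [phi [pP Dp up _ [s [ps Ds cphi sc]]]]] := core F S eps x 1 finF finS eps0 px x1 p1.
  by apply/eqP; exact: oner_neq0.
by exists s, p, phi.
Qed.
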